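(* Let $1\le q\le p<\infty$ and $q\le r\le\infty$ with $\frac1q=\frac1p+\frac1r$. Suppose $q\ne2$ and $2<r\le\infty$. Then there exists $\alpha>1$ such that the following holds. For every sequence $(k_n)_{n\in\mathbb N}$ of natural numbers for which there is a constant $c$ with $$\pi_{pq}(T)\le c\,\pi_{pq}^{k_n}(T)\quad\text{for all } n\in\mathbb N\text{ and all operators } T \text{ of rank } n,$$ there exists a constant $\bar c$ with $$n^\alpha\le\bar c\,k_n\quad\text{for all } n\in\mathbb N.$$
   Context: Operators are bounded linear operators between arbitrary Banach spaces. For $1\le q\le p\le\infty$, $m\in\mathbb N$ and a bounded linear operator $T:X\to Y$, the $(p,q)$-summing norm of $T$ with respect to $m$ vectors is $$\pi_{pq}^m(T)=\sup\Big\{\Big(\sum_{k=1}^m\|Tx_k\|^p\Big)^{1/p}\ :\ x_1,\dots,x_m\in X,\ \sup_{\|x^*\|_{X^*}\le1}\Big(\sum_{k=1}^m|\langle x_k,x^*\rangle|^q\Big)^{1/q}\le1\Big\},$$ and $\pi_{pq}(T)=\sup_m\pi_{pq}^m(T)$. *)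

(* Defs.v *)
From HB Require Import structures.
From mathcomp Require Import all_boot all_order all_algebra.
From mathcomp Require Import all_classical all_reals all_analysis.
From mathcomp.real_closed Require Import complex.

Set Implicit Arguments.
Unset Strict Implicit.
Unset Printing Implicit Defensive.

Import Order.TTheory GRing.Theory Num.Theory.
Import numFieldNormedType.Exports.

Local Open Scope classical_set_scope.
Local Open Scope ring_scope.

(* Banach spaces may be real or complex; everything below is parametrized by
   the choice of the scalar field. *)
Variant scalar_kind := RealScalars | ComplexScalars.

Definition scalars (R : realType) (F : scalar_kind) : numFieldType :=
  match F with
  | RealScalars => R
  | ComplexScalars => R[i]
  end.

Definition scalar_Re (R : realType) (F : scalar_kind) : scalars R F -> R :=
  match F with
  | RealScalars => fun a => a
  | ComplexScalars => fun a => complex.Re a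
  end.

(* In a normedModType over K the norm takes its values in K, i.e. in R[i] for
   complex spaces; since `|x| is a nonnegative real there, scalar_Re loses
   nothing. *)
Definition rnorm (R : realType) (F : scalar_kind)
    (X : normedModType (scalars R F)) (x : X) : R :=
  scalar_Re `|x|.

Definition opnorm (R : realType) (F : scalar_kind)
    (X Y : normedModType (scalars R F)) (T : {linear X -> Y}) : \bar R :=
  ereal_sup [set (rnorm (T x))%:E | x in [set x : X | rnorm x <= 1]].

Definition dual_ball (R : realType) (F : scalar_kind)
    (X : normedModType (scalars R F)) : set {linear X -> (scalars R F)^o} :=
  [set f | (opnorm f <= 1)%E].
Arguments dual_ball {R F} X.

Definition lnorm (R : realType) (p : R) (m : nat) (a : 'I_m -> R) : R :=
  (\sum_(k < m) a k `^ p) `^ p^-1.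

Definition weak_norm (R : realType) (F : scalar_kind)
    (X : normedModType (scalars R F)) (q : R) (m : nat) (x : 'I_m -> X) :
    \bar R :=
  ereal_sup [set (lnorm q (fun k => rnorm (f (x k))))%:E | f in dual_ball X].

(* The (p,q)-summing norm with respect to m vectors, for finite p and q. *)
Definition summing_norm_m (R : realType) (F : scalar_kind)
    (X Y : normedModType (scalars R F)) (p q : R) (m : nat)
    (T : {linear X -> Y}) : \bar R :=
  ereal_sup [set (lnorm p (fun k => rnorm (T (x k))))%:E
            | x in [set x : 'I_m -> X | (weak_norm q x <= 1)%E]].

Definition summing_norm (R : realType) (F : scalar_kind)
    (X Y : normedModType (scalars R F)) (p q : R)
    (T : {linear X -> Y}) : \bar R :=
  ereal_sup [set summing_norm_m p q m T | m in [set: nat]].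

(* The range of T is n-dimensional: it has a basis with n elements. *)
Definition has_rank (K : numFieldType) (X Y : lmodType K)
    (T : {linear X -> Y}) (n : nat) : Prop :=
  exists v : 'I_n -> Y,
    (forall a : 'I_n -> K, \sum_(i < n) a i *: v i = 0 -> forall i, a i = 0) /\
    range T = [set \sum_(i < n) a i *: v i | a in [set: 'I_n -> K]].

(* Main.v *)
(* The test operator is [T : X -> Y], [T e_k = y_k], where [X] is [K^N] normed by
   duality with [l_q^N], [Y] is [l_2^n], and the [y_k] are [N >= c n^beta],
   [beta > 1], unit vectors of [R^n] so well spread that
   [sum_k |<u, y_k>|^rho <= C] for all unit vectors [u], where [rho > 2] is
   prescribed.  The [N] vectors [e_k] have weak q-norm at most [1], hence
   [pi_pq(T) >= N^(1/p)]; it remains to find [eta > 0] such that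
   [pi_pq^m(T) <= D m^eta N^(1/p - eta)], since this forces [N <= const * k_n].
   - If [q > 2], take [rho = q]: then [T] is bounded uniformly in [n], and
     [eta = 1/p].
   - If [q < 2], then [|T x| <= C |x|_sigma] with [1/sigma + 1/rho = 1].  A
     family [x_j] of weak q-norm at most [1] satisfies both
     [sum_j |x_j|_q^q <= N] and [sum_j |x_j|_2^s <= N], [1/s = 1/q - 1/2], and
     interpolating between the two bounds the [(t,q)]-summing norm of [T] by
     [D N^(1/t)] for some [t > p]; this is where [1/q - 1/p < 1/2] enters. *)
Require Import Defs.
From HB Require Import structures.
From mathcomp Require Import all_boot all_order all_algebra.
From mathcomp Require Import all_classical all_reals all_analysis.
From mathcomp.real_closed Require Import complex.
From mathcomp Require Import ring lra zify.

Import Order.TTheory GRing.Theory Num.Theory.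
Import numFieldNormedType.Exports.

Local Open Scope classical_set_scope.
Local Open Scope ring_scope.

(** * Hoelder inequalities for finite sums *)

Lemma weighted_amgm (R : realType) (l a b : R) :
  0 <= l <= 1 -> 0 <= a -> 0 <= b ->
  a `^ l * b `^ (1 - l) <= l * a + (1 - l) * b.
Proof.
move=> /andP[l0 l1] a0 b0.
have [->|lN0] := eqVneq l 0; first by rewrite powRr0 subr0 powRr1 //; lra.
have [->|lN1] := eqVneq l 1; first by rewrite subrr powRr0 powRr1 //; lra.
have lp : 0 < l by rewrite lt_def lN0.
have l1p : 0 < 1 - l by rewrite subr_gt0 lt_def eq_sym lN1.
have := @conjugate_powR R (a `^ l) (b `^ (1 - l)) l^-1 (1 - l)^-1.
rewrite !powR_ge0 !invr_gt0 !invrK -!powRrM !mulfV ?gt_eqF // !powRr1 //.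
by move=> /(_ isT isT lp l1p); rewrite addrC subrK [l * a]mulrC [_ * b]mulrC; exact.
Qed.

(** Both families are normalized to sum 1 and [weighted_amgm] is added up. The endpoint weights are
    included because [weak_squares] uses the weight [1 - q^-1], which is 0 when [q = 1]. *)
Lemma holder2 (R : realType) (I : finType) (l : R) (a b : I -> R) :
  0 <= l <= 1 -> (forall i, 0 <= a i) -> (forall i, 0 <= b i) ->
  \sum_i a i `^ l * b i `^ (1 - l) <=
    (\sum_i a i) `^ l * (\sum_i b i) `^ (1 - l).
Proof.
move=> /andP[l0 l1] a0 b0.
have A0 : 0 <= \sum_i a i by apply: sumr_ge0.
have B0 : 0 <= \sum_i b i by apply: sumr_ge0.
have [->|lN0] := eqVneq l 0.
  rewrite powRr0 subr0 mul1r powRr1 //; apply: ler_sum => i _.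
  by rewrite powRr0 mul1r powRr1.
have [->|lN1] := eqVneq l 1.
  rewrite subrr powRr0 mulr1 powRr1 //; apply: ler_sum => i _.
  by rewrite powRr0 mulr1 powRr1.
have l1N0 : 1 - l != 0 by rewrite subr_eq0 eq_sym.
have [A_eq0|AN0] := eqVneq (\sum_i a i) 0.
  rewrite A_eq0 powR0 // mul0r big1 // => i _.
  move/eqP: A_eq0; rewrite psumr_eq0 // => /allP/(_ i).
  by rewrite mem_index_enum => /(_ isT)/= /eqP ->; rewrite powR0 // mul0r.
have [B_eq0|BN0] := eqVneq (\sum_i b i) 0.
  rewrite B_eq0 powR0 // mulr0 big1 // => i _.
  move/eqP: B_eq0; rewrite psumr_eq0 // => /allP/(_ i).
  by rewrite mem_index_enum => /(_ isT)/= /eqP ->; rewrite powR0 // mulr0.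
set A := \sum_i a i in A0 AN0 *; set B := \sum_i b i in B0 BN0 *.
have AB0 : 0 <= A `^ l * B `^ (1 - l) by rewrite mulr_ge0 ?powR_ge0.
have H i : a i `^ l * b i `^ (1 - l) <=
    A `^ l * B `^ (1 - l) * (l * (a i / A) + (1 - l) * (b i / B)).
  have -> : a i `^ l * b i `^ (1 - l) =
      A `^ l * B `^ (1 - l) * ((a i / A) `^ l * (b i / B) `^ (1 - l)).
    by rewrite mulrACA -!powRM ?divr_ge0 // ![_ * (_ / _)]mulrC !divfK.
  by apply: ler_wpM2l => //; apply: weighted_amgm; rewrite ?divr_ge0 ?l0.
apply: le_trans (ler_sum _ (fun i _ => H i)) _.
rewrite -mulr_sumr big_split /= -!mulr_sumr -!mulr_suml !divff // !mulr1.
by rewrite addrC subrK mulr1.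
Qed.

(** Two applications of [holder2]: the first separates [a] from [e], which merges [b] and [c] with
    relative weights [m] and [1 - m]; the second separates [b] from [c]. *)
Lemma holder3 (R : realType) (I : finType) (l1 l2 l3 : R) (a b c : I -> R) :
  0 < l1 -> 0 < l2 -> 0 < l3 -> l1 + l2 + l3 = 1 ->
  (forall i, 0 <= a i) -> (forall i, 0 <= b i) -> (forall i, 0 <= c i) ->
  \sum_i a i `^ l1 * b i `^ l2 * c i `^ l3 <=
    (\sum_i a i) `^ l1 * (\sum_i b i) `^ l2 * (\sum_i c i) `^ l3.
Proof.
move=> l1p l2p l3p l123 a0 b0 c0.
have d0 : 0 < 1 - l1 by lra.
have dN0 := lt0r_neq0 d0.
pose m := l2 / (1 - l1).
have m01 : 0 <= m <= 1.
  by rewrite /m divr_ge0 ?(ltW l2p) ?(ltW d0) //= ler_pdivrMr // mul1r; lra.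
have m2 : m * (1 - l1) = l2 by rewrite /m divfK.
have m3 : (1 - m) * (1 - l1) = l3 by rewrite mulrBl m2 mul1r; lra.
pose e i := b i `^ m * c i `^ (1 - m).
have e0 i : 0 <= e i by rewrite mulr_ge0 ?powR_ge0.
have -> : \sum_i a i `^ l1 * b i `^ l2 * c i `^ l3 =
          \sum_i a i `^ l1 * e i `^ (1 - l1).
  apply: eq_bigr => i _.
  by rewrite /e powRM ?powR_ge0 // -!powRrM m2 m3 mulrA.
apply: le_trans (holder2 _ _ _ _ _ _ _ _) _ => //; first by lra.
rewrite -mulrA; apply: ler_wpM2l; first exact: powR_ge0.
have -> : (\sum_i b i) `^ l2 * (\sum_i c i) `^ l3 =
    ((\sum_i b i) `^ m * (\sum_i c i) `^ (1 - m)) `^ (1 - l1).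
  by rewrite powRM ?powR_ge0 // -!powRrM m2 m3.
apply: ge0_ler_powR; rewrite ?nnegrE ?(ltW d0) //.
- exact: sumr_ge0.
- by rewrite mulr_ge0 ?powR_ge0.
exact: holder2.
Qed.

(** * Incoherent systems of vectors *)

Definition dot (R : realType) (I : finType) (u v : I -> R) : R :=
  \sum_i u i * v i.
Arguments dot {R I} u v.

Lemma dot_ge0 (R : realType) (I : finType) (u : I -> R) : 0 <= dot u u.
Proof. by apply: sumr_ge0 => i _; rewrite -expr2 sqr_ge0. Qed.

(** Let v be the sum of <u, y_k> y_k over [P]. Then <u, v> is the sum of squares S, and |v|^2 is the
    Gram form, at most kappa S by hypothesis. Expanding 0 <= |kappa u - v|^2 gives S <= kappa
    |u|^2. *)
Lemma bessel_of_gram (R : realType) (I J : finType) (u : I -> R)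
    (y : J -> I -> R) (P : pred J) (kappa : R) :
  0 < kappa ->
  \sum_(j | P j) \sum_(k | P k)
     dot u (y j) * dot u (y k) * dot (y j) (y k) <=
    kappa * \sum_(k | P k) dot u (y k) ^+ 2 ->
  \sum_(k | P k) dot u (y k) ^+ 2 <= kappa * dot u u.
Proof.
move=> kp.
set D := (X in X <= _ -> _); set S := \sum_(k | P k) _ ^+ 2 => DS.
pose v i := \sum_(k | P k) dot u (y k) * y k i.
have uv : dot u v = S.
  rewrite /dot /S; under eq_bigr do rewrite mulr_sumr.
  rewrite exchange_big /=; apply: eq_bigr => k _.
  rewrite expr2 [in RHS]/dot mulr_sumr; apply: eq_bigr => i _.
  by rewrite -/(dot u (y k)); ring.
have vv : dot v v = D.
  rewrite /D {1}/dot.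
  under eq_bigr => i _ do rewrite {1}/v mulr_suml.
  rewrite exchange_big /=; apply: eq_bigr => j _.
  under eq_bigr => i _ do rewrite /v mulr_sumr.
  rewrite exchange_big /=; apply: eq_bigr => k _.
  rewrite {5}/dot mulr_sumr; apply: eq_bigr => i _; ring.
have : 0 <= dot (fun i => kappa * u i - v i) (fun i => kappa * u i - v i).
  exact: dot_ge0.
have -> : dot (fun i => kappa * u i - v i) (fun i => kappa * u i - v i) =
    kappa ^+ 2 * dot u u - 2 * kappa * dot u v + dot v v.
  rewrite /dot !mulr_sumr -sumrB -big_split /=.
  by apply: eq_bigr => i _; ring.
rewrite uv vv => H.
have : 0 <= kappa * (kappa * dot u u - S).
  by apply: le_trans H _; move: DS; lra.
by rewrite pmulr_rge0 // subr_ge0.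
Qed.

(** The off-diagonal Gram entries are absorbed by 2ab <= a^2 + b^2. The bound is effective for sets
    [P] of cardinality O(1/mu). *)
Lemma coherent_bessel (R : realType) (I J : finType) (u : I -> R)
    (y : J -> I -> R) (P : pred J) (mu : R) :
  0 <= mu -> (forall j, dot (y j) (y j) = 1) ->
  (forall j k, j != k -> `|dot (y j) (y k)| <= mu) ->
  \sum_(k | P k) dot u (y k) ^+ 2 <= (1 + mu * #|P|%:R) * dot u u.
Proof.
move=> mu0 y1 yjk.
apply: bessel_of_gram; first by have : 0 <= mu * #|P|%:R :> R; [rewrite mulr_ge0 | lra].
set g := fun k => dot u (y k).
have H j k : g j * g k * dot (y j) (y k) <=
    (if j == k then g k ^+ 2 else 0) + (mu / 2) * (g j ^+ 2 + g k ^+ 2).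
  have [->|jk] := eqVneq j k.
    by rewrite y1 mulr1 -expr2 lerDl mulr_ge0 ?divr_ge0 // addr_ge0 ?sqr_ge0.
  rewrite add0r; apply: le_trans (ler_norm _) _.
  rewrite normrM normrM; apply: (@le_trans _ _ (`|g j| * `|g k| * mu)).
    by apply: ler_wpM2l; [rewrite mulr_ge0 | exact: yjk].
  rewrite -[g j ^+ 2]real_normK ?num_real // -[g k ^+ 2]real_normK ?num_real //.
  have := sqr_ge0 (`|g j| - `|g k|); set a := `|g j|; set b := `|g k| => ab.
  have : 0 <= mu * (a - b) ^+ 2 by rewrite mulr_ge0.
  by lra.
apply: le_trans (ler_sum _ (fun j _ => ler_sum _ (fun k _ => H j k))) _.
rewrite le_eqVlt; apply/orP; left; apply/eqP.
under eq_bigr => j Pj.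
  rewrite big_split /= -mulr_sumr big_split /= sumr_const.
  rewrite -big_mkcondr /= (bigD1 j) ?Pj ?eqxx //= big1; last first.
    by move=> k /andP[/andP[_ /eqP ->]]; rewrite eqxx.
  rewrite addr0.
  over.
rewrite big_split /= -mulr_sumr big_split /= sumr_const sumrMnl.
by rewrite -mulr_natr; set S := \sum_(i | P i) _; rewrite -/S; field.
Qed.

(** Coefficients are split at the level g^2 = 2 mu. The large ones are so few that their squares sum
    to at most 2; each small one gains the factor (2 mu)^((rho - 2)/2) over its square. *)
Lemma incoherent_power_sum (R : realType) (I J : finType) (u : I -> R)
    (y : J -> I -> R) (mu B rho : R) :
  0 < mu -> 2 < rho -> dot u u <= 1 -> (forall j, dot (y j) (y j) = 1) ->
  (forall j k, j != k -> `|dot (y j) (y k)| <= mu) ->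
  \sum_k dot u (y k) ^+ 2 <= B ->
  \sum_k `|dot u (y k)| `^ rho <= 2 + (2 * mu) `^ ((rho - 2) / 2) * B.
Proof.
move=> mu0 rho2 u1 y1 yjk yB.
set g := fun k => dot u (y k).
pose P : pred J := fun k => 2 * mu <= g k ^+ 2.
have SP (Q : pred J) : \sum_(k | Q k) g k ^+ 2 <= 1 + mu * #|Q|%:R.
  apply: le_trans (coherent_bessel _ _ _ u y Q mu (ltW mu0) y1 yjk) _.
  by rewrite ler_piMr // addr_ge0 // mulr_ge0 // ltW.
(* Each index of [P] contributes at least 2 mu to a sum bounded by 1 + mu |P|; hence mu |P| <= 1. *)
have cardP : 2 * mu * #|P|%:R <= 1 + mu * #|P|%:R.
  apply: le_trans (SP P); rewrite mulr_natr -sumr_const.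
  exact: ler_sum.
have SP2 : \sum_(k | P k) g k ^+ 2 <= 2 by apply: le_trans (SP P) _; lra.
have g1 k : `|g k| <= 1.
  rewrite -(@expr_le1 _ 2) // real_normK ?num_real //.
  (* For a single unit vector Bessel's inequality is Cauchy-Schwarz. *)
  have := @bessel_of_gram R I J u y (pred1 k) 1 ltr01.
  rewrite !big_pred1_eq y1 !mul1r mulr1 expr2 => /(_ (lexx _)) H.
  exact: le_trans H u1.
have gpow k : `|g k| `^ rho = (g k ^+ 2) `^ ((rho - 2) / 2) * g k ^+ 2.
  rewrite -[g k ^+ 2]real_normK ?num_real // -powR_mulrn // -powRrM.
  rewrite -powRD; last by apply/implyP => /eqP; lra.
  by congr (_ `^ _); field.
rewrite (bigID P) /=; apply: lerD.
  apply: le_trans SP2; apply: ler_sum => k _; rewrite gpow.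
  rewrite ler_piMl ?sqr_ge0 //.
  apply: (@le_trans _ _ (1 `^ ((rho - 2) / 2))); last by rewrite powR1.
  apply: ge0_ler_powR; rewrite ?nnegrE ?sqr_ge0 //; first by lra.
  by rewrite -[g k ^+ 2]real_normK ?num_real // expr_le1.
apply: (@le_trans _ _ ((2 * mu) `^ ((rho - 2) / 2) * \sum_k g k ^+ 2)).
  rewrite mulr_sumr [leRHS](bigID P) /= ler_wpDl //.
    by apply: sumr_ge0 => k _; rewrite mulr_ge0 ?powR_ge0 ?sqr_ge0.
  apply: ler_sum => k; rewrite /P -ltNge => Pk; rewrite gpow.
  apply: ler_wpM2r; first exact: sqr_ge0.
  apply: ge0_ler_powR; rewrite ?nnegrE ?sqr_ge0 //; first by lra.
    by lra.
  exact: ltW.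
by apply: ler_wpM2l => //; exact: powR_ge0.
Qed.

(** * Construction of spread vectors from lines and Hadamard matrices *)

(** Sylvester's doubling: H is replaced by the block matrix with rows (H, H) and (H, -H); [sgn] is
    the block sign and [base] the index within a block. *)
Lemma hadamard_exists (R : realType) (h : nat) :
  exists H : 'I_(2 ^ h) -> 'I_(2 ^ h) -> R,
    (forall i x, H i x ^+ 2 = 1) /\
    (forall i j, i != j -> \sum_x H i x * H j x = 0).
Proof.
elim: h => [|h [H [H2 HO]]].
  exists (fun _ _ => 1); split=> [i x|i j]; first by rewrite expr1n.
  by rewrite (ord1 i) (ord1 j) eqxx.
rewrite expnS mul2n -addnn.
pose sgn (i x : 'I_(2 ^ h + 2 ^ h)) : R :=
  match fintype.split i, fintype.split x with inr _, inr _ => -1 | _, _ => 1 end.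
pose base (i : 'I_(2 ^ h + 2 ^ h)) : 'I_(2 ^ h) :=
  match fintype.split i with inl k => k | inr k => k end.
exists (fun i x => sgn i x * H (base i) (base x)).
split=> [i x|i j ij].
  by rewrite exprMn H2 mulr1 /sgn; case: (fintype.split i); case: (fintype.split x) => *;
    rewrite ?expr1n ?sqrrN ?expr1n.
rewrite big_split_ord /=.
have bl x : base (lshift (2 ^ h) x) = x.
  by rewrite /base -[lshift _ _]/(unsplit (inl x)) unsplitK.
have br x : base (rshift (2 ^ h) x) = x.
  by rewrite /base -[rshift _ _]/(unsplit (inr x)) unsplitK.
have sl k x : sgn k (lshift (2 ^ h) x) = 1.
  by rewrite /sgn -[lshift _ _]/(unsplit (inl x)) unsplitK; case: (fintype.split k).
have sr k x : sgn k (rshift (2 ^ h) x) = if fintype.split k is inr _ then -1 else 1.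
  by rewrite /sgn -[rshift _ _]/(unsplit (inr x)) unsplitK; case: (fintype.split k).
under eq_bigr do rewrite bl !sl !mul1r.
under [X in _ + X]eq_bigr do rewrite br !sr mulrACA.
rewrite -mulr_sumr; have [bij|/HO ->] := eqVneq (base i) (base j); last first.
  by rewrite mulr0 addr0.
set S := \sum_x _.
(* Distinct indices with the same base lie in different halves, so exactly one of the two signs is
   -1 and the two block sums cancel. *)
suff -> : (if fintype.split i is inr _ then -1 else 1) *
          (if fintype.split j is inr _ then -1 else 1) = -1 :> R.
  by rewrite mulN1r subrr.
move: ij bij; rewrite /base -(inj_eq (can_inj (@splitK _ _))).
by case: (fintype.split i) => a; case: (fintype.split j) => b ij ab; move: ij;
  rewrite ab ?eqxx ?mul1r ?mulr1.
Qed.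

(** Subtracting the congruences gives d x = d x' modulo Q b with 0 < d < b. Both sides are smaller
    than Q b, so they agree as integers; the modulus may therefore be composite. *)
Lemma lines_meet_once (Q b s s' c c' x x' : nat) :
  (s < b)%N -> (s' < b)%N -> s != s' -> (x < Q)%N -> (x' < Q)%N ->
  s * x + c = s' * x + c' %[mod Q * b] ->
  s * x' + c = s' * x' + c' %[mod Q * b] -> x = x'.
Proof.
wlog ss' : s s' c c' / (s < s')%N => [hw sb sb' /[dup] ne|].
  rewrite neq_ltn => /orP[/hw|/hw h x1 x2 e1 e2]; first exact.
  by apply: (h c' c) => //; rewrite eq_sym.
move=> sb s'b _ xQ x'Q.
have {s'b sb ss'} [d [d0 db ->]] : exists d, [/\ (0 < d)%N, (d < b)%N & s' = (s + d)%N].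
  by exists (s' - s)%N; split; lia.
rewrite !mulnDl -!addnA => /eqP; rewrite eqn_modDl => /eqP e1.
move=> /eqP; rewrite eqn_modDl => /eqP; rewrite e1 => /eqP.
rewrite eqn_modDr => /eqP; rewrite !modn_small; first by nia.
- by rewrite mulnC; apply: ltn_mul.
- by rewrite mulnC; apply: ltn_mul.
Qed.

(* The vectors are supported on the lines z = s x + c of 'I_Q x Z/(Qb), with
   the rows of a Hadamard matrix along each line: every slope s gives an
   orthonormal basis, and lines of different slopes meet at most once. *)
Lemma line_frame (R : realType) (b Q : nat) (H : 'I_Q -> 'I_Q -> R) :
  (0 < b)%N -> (0 < Q)%N -> (forall i x, H i x ^+ 2 = 1) ->
  (forall i j, i != j -> \sum_x H i x * H j x = 0) ->
  exists y : 'I_b * ('I_(Q * b) * 'I_Q) -> 'I_Q * 'I_(Q * b) -> R,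
    [/\ forall j, dot (y j) (y j) = 1,
        forall j k, j != k -> `|dot (y j) (y k)| <= Q%:R^-1 &
        forall u, \sum_k dot u (y k) ^+ 2 <= b%:R * dot u u].
Proof.
move=> b0 Q0 H2 HO.
have M0 : (0 < Q * b)%N by rewrite muln_gt0 Q0.
pose pt (s : 'I_b) (c : 'I_(Q * b)) (x : 'I_Q) : 'I_(Q * b) :=
  Ordinal (ltn_pmod (s * x + c) M0).
(* A line carries Q points, one for each abscissa, and Hadamard entries are signs: dividing by sqrt
   Q gives norm 1. *)
pose y (j : 'I_b * ('I_(Q * b) * 'I_Q)) (i : 'I_Q * 'I_(Q * b)) : R :=
  (i.2 == pt j.1 j.2.1 i.1)%:R * (H j.2.2 i.1 / Num.sqrt Q%:R).
have QR0 : 0 < Q%:R :> R by rewrite ltr0n.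
have QN0 := lt0r_neq0 QR0.
have dotE j k : dot (y j) (y k) =
    Q%:R^-1 * \sum_x (pt j.1 j.2.1 x == pt k.1 k.2.1 x)%:R *
                     (H j.2.2 x * H k.2.2 x).
  rewrite /dot -(pair_bigA _ (fun x z => y j (x, z) * y k (x, z))) /=.
  rewrite mulr_sumr; apply: eq_bigr => x _.
  rewrite (bigD1 (pt j.1 j.2.1 x)) //= big1 ?addr0; last first.
    by move=> z /negPf zN; rewrite /y /= zN !mul0r.
  rewrite /y /= eqxx mul1r; set e := (_ == _)%:R.
  have -> : Q%:R^-1 = (Num.sqrt Q%:R)^-1 * (Num.sqrt Q%:R)^-1 :> R.
    by rewrite -invfM -expr2 sqr_sqrtr // ltW.
  by ring.
have y1 j : dot (y j) (y j) = 1.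
  rewrite dotE; under eq_bigr do rewrite eqxx mul1r -expr2 H2.
  by rewrite sumr_const card_ord mulVf.
(* Same slope: lines with different intercepts are disjoint, and on a common line distinct Hadamard
   rows are orthogonal. *)
have yO s c c' i i' : (c, i) != (c', i') -> dot (y (s, (c, i))) (y (s, (c', i'))) = 0.
  move=> ne; rewrite dotE /=.
  have [cc'|cc'] := eqVneq c c'.
    subst c'; under eq_bigr do rewrite eqxx mul1r.
    by rewrite HO ?mulr0 //; apply: contraNneq ne => ->.
  rewrite big1 ?mulr0 // => x _; case: eqP => [/(congr1 val)/= /eqP|]; last by rewrite mul0r.
  rewrite eqn_modDl !modn_small // => /eqP/val_inj e.
  by rewrite e eqxx in cc'.
exists y; split=> // [[s [c i]] [s' [c' i']] ne|u].
  have [ss'|ss'] := eqVneq s s'.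
    rewrite -ss' yO ?normr0 ?invr_ge0 ?ltW //.
    by apply: contraNneq ne => ->; rewrite ss'.
  rewrite dotE /= normrM ger0_norm ?invr_ge0 ?(ltW QR0) //.
  rewrite ler_piMr ?invr_ge0 ?(ltW QR0) //.
  have Hn k x : `|H k x| = 1.
    by apply/eqP; rewrite -(@eqrXn2 _ 2) // real_normK ?num_real // H2 expr1n.
  (* Different slopes: there is at most one common point, and it contributes a term of modulus 1
     before the factor 1/Q. *)
  have [x /eqP px|noteq] := pickP (fun x => pt s c x == pt s' c' x); last first.
    by rewrite big1 ?normr0 // => x _; rewrite noteq mul0r.
  rewrite (bigD1 x) //= big1 ?addr0; last first.
    move=> x' xx'; case: eqP => [px'|]; last by rewrite mul0r.
    move/(congr1 val): px => /= px; move/(congr1 val): px' => /= px'.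
    case/eqP: xx'; apply: val_inj => /=.
    by apply: (@lines_meet_once Q b s s' c c').
  by rewrite px eqxx mul1r normrM !Hn mulr1.
rewrite -(pair_bigA _ (fun s t => dot u (y (s, t)) ^+ 2)) /=.
have -> : b%:R * dot u u = \sum_(s < b) dot u u.
  by rewrite sumr_const card_ord mulr_natl.
(* For each slope this is Bessel's inequality of an orthonormal system; the b slopes add up to the
   factor b. *)
apply: ler_sum => s _.
rewrite -[leRHS]mul1r.
apply: (@bessel_of_gram R _ _ u (fun t => y (s, t)) predT 1 ltr01).
rewrite mul1r le_eqVlt; apply/orP; left; apply/eqP; apply: eq_bigr => t _.
rewrite (bigD1 t) //= big1 ?addr0 ?y1 ?mulr1 ?expr2 //.
by case: t => c i [c' i']; rewrite eq_sym => ne; rewrite yO // mulr0.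
Qed.

(* With [b = 2 ^ l] and [Q = b ^ a], the line frame has [b ^ (2 a + 2)] vectors
   in dimension [b ^ (2 a + 1)]; its Bessel constant [b] is compensated by the
   coherence [1 / Q] as soon as [a (rho - 2) / 2 >= 1]. *)
Lemma spread_vectors (R : realType) (rho : R) : 2 < rho ->
  exists beta C : R, 1 < beta /\ forall n : nat, (0 < n)%N ->
  exists (N : nat) (y : 'I_N -> 'I_n -> R),
    [/\ n%:R `^ beta <= C * N%:R,
        forall k, dot (y k) (y k) = 1,
        forall i, exists k, forall j, y k j = (i == j)%:R &
        forall u, dot u u <= 1 -> \sum_k `|dot u (y k)| `^ rho <= C].
Proof.
move=> rho2.
have [a a0 arho] : exists2 a : nat, (0 < a)%N & 1 <= a%:R * ((rho - 2) / 2).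
  have r0 : 0 < (rho - 2) / 2 by lra.
  exists (Num.truncn ((rho - 2) / 2)^-1).+1 => //.
  have := truncnS_gt ((rho - 2) / 2)^-1.
  by rewrite -(ltr_pM2r r0) mulVf ?gt_eqF // => /ltW.
pose A := (2 * a + 1)%N.
pose beta : R := (2 * a + 2)%:R / A%:R.
have A0 : 0 < A%:R :> R by rewrite ltr0n /A addn1.
pose C1 : R := 2 `^ ((rho - 2) / 2).
exists beta, (3 + C1 + (2 ^ (2 * a + 2))%:R); split.
  by rewrite /beta ltr_pdivlMr // mul1r ltr_nat /A; lia.
move=> n n0.
(* The largest l for which the frame dimension 2^(A l) is at most n; thus n < 2^(A (l + 1)). *)
pose l := trunc_log (2 ^ A) n.
have A1 : (1 < 2 ^ A)%N by rewrite -[1%N](expn0 2) ltn_exp2l // /A addn1.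
have /andP[ln nl] := trunc_log_bounds A1 n0.
rewrite -/l in ln nl.
pose b := (2 ^ l)%N; pose Q := (2 ^ (a * l))%N.
have b0 : (0 < b)%N by rewrite expn_gt0.
have Q0 : (0 < Q)%N by rewrite expn_gt0.
have [H [H2 HO]] := hadamard_exists R (a * l).
have [y [y1 yjk yB]] := line_frame R b Q H b0 Q0 H2 HO.
set I := ('I_Q * 'I_(Q * b))%type in y y1 yjk yB.
set J := ('I_b * ('I_(Q * b) * 'I_Q))%type in y y1 yjk yB.
have cardI : (#|{: I}| <= n)%N.
  rewrite card_prod !card_ord; apply: leq_trans ln.
  by rewrite /Q /b -expnM -!expnD leq_exp2l // /A; lia.
have cardJ : #|{: J}| = (2 ^ ((2 * a + 2) * l))%N.
  rewrite !card_prod !card_ord /Q /b -!expnD; congr (2 ^ _)%N; lia.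
pose f (x : I) : 'I_n := widen_ord cardI (enum_rank x).
have f_inj : injective f.
  by move=> x x' /(congr1 val)/= /val_inj /enum_rank_inj.
(* The frame lives in the first coordinates; the standard basis of R^n is adjoined so that the
   synthesis operator has rank exactly n. *)
pose z (k : 'I_n + J) (i : 'I_n) : R :=
  match k with
  | inl k => (k == i)%:R
  | inr k => \sum_x (f x == i)%:R * y k x
  end.
have dotl u k : dot u (z (inl k)) = u k.
  rewrite /dot (bigD1 k) //= eqxx mulr1 big1 ?addr0 // => i.
  by rewrite eq_sym => /negPf ->; rewrite mulr0.
have dotr u k : dot u (z (inr k)) = dot (u \o f) (y k).
  rewrite /dot /=; under eq_bigr do rewrite mulr_sumr.
  rewrite exchange_big /=; apply: eq_bigr => x _.
  rewrite (bigD1 (f x)) //= eqxx mul1r big1 ?addr0 // => i.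
  by rewrite eq_sym => /negPf ->; rewrite mul0r mulr0.
have dotf (u : 'I_n -> R) : dot (u \o f) (u \o f) <= dot u u.
  rewrite /dot [leRHS](bigID (mem (f @: [set: I]))) /=.
  rewrite big_imset /=; last by move=> ? ? _ _; exact: f_inj.
  under [X in X + _]eq_bigl do rewrite in_setT.
  by rewrite lerDl; apply: sumr_ge0 => i _; rewrite -expr2 sqr_ge0.
pose N := #|{: 'I_n + J}|.
have sumN (g : 'I_n + J -> R) : \sum_(k < N) g (enum_val k) = \sum_k g k.
  rewrite [RHS](reindex (fun k : 'I_N => enum_val k)) //.
  by apply: onW_bij; exact: enum_val_bij.
exists N, (fun k => z (enum_val k)); split.
(* Since A beta = 2a + 2, n^beta is at most 2^((2a + 2)(l + 1)), which is 2^(2a + 2) times the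
   number of frame vectors. *)
- have nN : n%:R `^ beta <= (2 ^ (2 * a + 2))%:R * #|{: J}|%:R :> R.
    rewrite cardJ -natrM -expnD.
    apply: (@le_trans _ _ (((2 ^ A) ^ l.+1)%:R `^ beta)).
      apply: ge0_ler_powR; rewrite ?nnegrE ?ler_nat ?(ltnW nl) //.
      by rewrite divr_ge0 // ltW.
    rewrite -expnM natrX -powR_mulrn // -powRrM natrM.
    have -> : A%:R * l.+1%:R * beta = (2 * a + 2 + (2 * a + 2) * l)%:R.
      rewrite natrD natrM /beta -[l.+1]addn1 natrD; field.
      exact: lt0r_neq0.
    by rewrite powR_mulrn // -natrX.
  apply: le_trans nN _.
  have C1p : 0 <= C1 by exact: powR_ge0.
  have JN : #|{: J}|%:R <= N%:R :> R by rewrite ler_nat /N card_sum leq_addl.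
  apply: ler_pM => //.
  by lra.
- move=> k; case: (enum_val k) => j; first by rewrite dotl /= eqxx.
  rewrite dotr -[RHS](y1 j); apply: eq_bigr => x _ /=; congr (_ * _).
  rewrite (bigD1 x) //= eqxx mul1r big1 ?addr0 // => x' xx'.
  by rewrite (inj_eq f_inj) (negPf xx') mul0r.
- by move=> i; exists (enum_rank (inl i : 'I_n + J)) => j; rewrite enum_rankK.
- move=> u u1; rewrite (sumN (fun k => `|dot u (z k)| `^ rho)) big_sumType /=.
  under eq_bigr do rewrite dotl.
  under [X in _ + X]eq_bigr do rewrite dotr.
  have ufu := le_trans (dotf u) u1.
  have QR0 : 0 < Q%:R^-1 :> R by rewrite invr_gt0 ltr0n.
  (* The adjoined basis vectors contribute at most |u|^2, since |u_i| <= 1 and rho > 2. *)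
  have S1 : \sum_i `|u i| `^ rho <= 1.
    apply: le_trans (u1); apply: ler_sum => i _.
    have ui2 : `|u i| ^+ 2 <= u i * u i by rewrite real_normK ?num_real.
    have ui1 : `|u i| <= 1.
      rewrite -(@expr_le1 _ 2) //; apply: le_trans ui2 _; apply: le_trans (u1).
      rewrite /dot (bigD1 i) //= lerDl.
      by apply: sumr_ge0 => j _; rewrite -expr2 sqr_ge0.
    apply: le_trans ui2; have [->|uN0] := eqVneq `|u i| 0.
      by rewrite powR0 ?sqr_ge0 //; lra.
    rewrite -powR_mulrn //; apply: ger_powR; last exact: ltW.
    by rewrite ui1 lt_def uN0 normr_ge0.
  have S2 := @incoherent_power_sum R I J (u \o f) y Q%:R^-1 b%:R rho
    QR0 rho2 ufu y1 yjk (le_trans (yB _) (ler_piMr (ler0n _ _) ufu)).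
  (* Q = b^a and a (rho - 2)/2 >= 1 give Q^((rho - 2)/2) >= b, which cancels the Bessel constant. *)
  have S3 : (2 * Q%:R^-1) `^ ((rho - 2) / 2) * b%:R <= C1.
    rewrite powRM ?invr_ge0 ?ler0n // -mulrA ler_piMr ?powR_ge0 //.
    rewrite -powR_inv1 ?ler0n // -powRrM mulN1r powRN mulrC.
    rewrite ler_pdivrMr ?mul1r ?powR_gt0 ?ltr0n // /Q mulnC expnM natrX.
    rewrite -powR_mulrn ?ler0n // -powRrM; apply: le1r_powR => //.
    by rewrite ler1n.
  have : 0 <= (2 ^ (2 * a + 2))%:R :> R by [].
  by lra.
Qed.

(** * Real and complex scalars *)

Definition scal (R : realType) (F : scalar_kind) (x : R) : scalars R F :=
  match F with
  | RealScalars => x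
  | ComplexScalars => real_complex R x
  end.
Arguments scal {R} F x.

Definition scalar_Im (R : realType) (F : scalar_kind) : scalars R F -> R :=
  match F with
  | RealScalars => fun=> 0
  | ComplexScalars => fun a => complex.Im a
  end.

Arguments scalar_Im {R F} a.

(** Rebuilds a limit from the limits of its real and imaginary parts; over the reals [scalar_Im]
    vanishes and the second argument is dropped. *)
Definition scalar_mk (R : realType) (F : scalar_kind) (x y : R) : scalars R F :=
  match F with
  | RealScalars => x
  | ComplexScalars => Complex x y
  end.
Arguments scalar_mk {R} F x y.

Definition rabs (R : realType) (F : scalar_kind) (a : scalars R F) : R :=
  scalar_Re `|a|.
Arguments rabs {R F} a.

Lemma scal_is_zmod_morphism (R : realType) (F : scalar_kind) :
  zmod_morphism (@scal R F).
Proof. by case: F => x y //=; rewrite rmorphB. Qed.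

Lemma scal_is_monoid_morphism (R : realType) (F : scalar_kind) :
  monoid_morphism (@scal R F).
Proof. by case: F; split => // x y; apply: (rmorphM (real_complex R)). Qed.

HB.instance Definition _ (R : realType) (F : scalar_kind) :=
  GRing.isZmodMorphism.Build R (scalars R F) (@scal R F)
    (@scal_is_zmod_morphism R F).
HB.instance Definition _ (R : realType) (F : scalar_kind) :=
  GRing.isMonoidMorphism.Build R (scalars R F) (@scal R F)
    (@scal_is_monoid_morphism R F).

Lemma scalar_Re_is_zmod_morphism (R : realType) (F : scalar_kind) :
  zmod_morphism (@scalar_Re R F).
Proof. by case: F => x y //=; case: x => ? ?; case: y. Qed.

Lemma scalar_Im_is_zmod_morphism (R : realType) (F : scalar_kind) :
  zmod_morphism (@scalar_Im R F).
Proof. by case: F => x y //=; [rewrite subrr | case: x => ? ?; case: y]. Qed.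

HB.instance Definition _ (R : realType) (F : scalar_kind) :=
  GRing.isZmodMorphism.Build (scalars R F) R (@scalar_Re R F)
    (@scalar_Re_is_zmod_morphism R F).
HB.instance Definition _ (R : realType) (F : scalar_kind) :=
  GRing.isZmodMorphism.Build (scalars R F) R (@scalar_Im R F)
    (@scalar_Im_is_zmod_morphism R F).

Section Scalars.
Context {R : realType} {F : scalar_kind}.
Implicit Types (a b : scalars R F) (x y : R).

Lemma scalK : cancel (@scal R F) (@scalar_Re R F).
Proof. by case: F. Qed.

Lemma ler_scal x y : (scal F x <= scal F y) = (x <= y).
Proof. by case: F => //=; rewrite lecR. Qed.

Lemma ltr_scal x y : (scal F x < scal F y) = (x < y).
Proof. by rewrite !lt_neqAle ler_scal (inj_eq (can_inj scalK)). Qed.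

Lemma normr_scal a : `|a| = scal F (rabs a).
Proof.
by rewrite /rabs; case: F a => /= [a|[u v]].
Qed.

Lemma rabs_scal x : rabs (scal F x) = `|x|.
Proof.
rewrite /rabs; case: F => //=.
by rewrite /= expr0n addr0 sqrtr_sqr.
Qed.

Lemma rabs0 : rabs (0 : scalars R F) = 0.
Proof. by rewrite -[0 in LHS](rmorph0 (scal F)) rabs_scal normr0. Qed.

Lemma rabs1 : rabs (1 : scalars R F) = 1.
Proof. by rewrite -[1 in LHS](rmorph1 (scal F)) rabs_scal normr1. Qed.

Lemma rabs_ge0 a : 0 <= rabs a.
Proof. by rewrite -ler_scal rmorph0 -normr_scal. Qed.

Lemma rabs_eq0 a : rabs a = 0 -> a = 0.
Proof. by move=> a0; apply/eqP; rewrite -normr_eq0 normr_scal a0 rmorph0. Qed.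

(** In the order of R[i] only real numbers are positive, so a scalar epsilon can be replaced by a
    real one. *)
Lemma gt0_scal a : 0 < a -> exists2 x, 0 < x & a = scal F x.
Proof.
move=> a0; exists (rabs a); last by rewrite -normr_scal gtr0_norm.
rewrite lt_def rabs_ge0 andbT.
by apply: contraTneq a0 => /rabs_eq0 ->; rewrite ltxx.
Qed.

Lemma rabsM a b : rabs (a * b) = rabs a * rabs b.
Proof.
by rewrite -[LHS]scalK -normr_scal normrM !normr_scal -rmorphM /= scalK.
Qed.

Lemma rabsD a b : rabs (a + b) <= rabs a + rabs b.
Proof. by rewrite -ler_scal rmorphD /= -!normr_scal ler_normD. Qed.

Lemma rabsN a : rabs (- a) = rabs a.
Proof. by rewrite /rabs normrN. Qed.

Lemma rabs_sum (I : finType) (f : I -> scalars R F) :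
  rabs (\sum_i f i) <= \sum_i rabs (f i).
Proof.
elim/big_ind2: _ => [|a x b y ax bY|//]; first by rewrite rabs0.
exact: le_trans (rabsD _ _) (lerD ax bY).
Qed.

(** For nonzero [a] this is the conjugate of [a] over its modulus. The convention for division by 0
    makes it 0 at [a = 0], hence the inequality in [rabs_phase]. *)
Definition phase a : scalars R F := scal F (rabs a) / a.

Lemma phaseM a : phase a * a = scal F (rabs a).
Proof.
have [->|aN0] := eqVneq a 0; first by rewrite mulr0 rabs0 rmorph0.
by rewrite /phase divfK.
Qed.

Lemma rabs_phase a : rabs (phase a) <= 1.
Proof.
have [->|aN0] := eqVneq a 0; first by rewrite /phase invr0 mulr0 rabs0.
have raN0 : rabs a != 0 by apply: contraNneq aN0 => /rabs_eq0 ->.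
rewrite -(@ler_pM2r _ (rabs a)) ?lt_def ?raN0 ?rabs_ge0 // -rabsM phaseM.
by rewrite rabs_scal mul1r ger0_norm ?rabs_ge0.
Qed.

Lemma rabs_sqr a : rabs a ^+ 2 = scalar_Re a ^+ 2 + scalar_Im a ^+ 2.
Proof.
rewrite /rabs; case: F a => /= [a|[u v]].
  by rewrite expr0n addr0 real_normK ?num_real.
by rewrite /= sqr_sqrtr // addr_ge0 ?sqr_ge0.
Qed.

Lemma rabs_parallelogram a b :
  rabs (a + b) ^+ 2 + rabs (a - b) ^+ 2 = 2 * rabs a ^+ 2 + 2 * rabs b ^+ 2.
Proof. by rewrite !rabs_sqr !raddfD !raddfN /=; ring. Qed.

Lemma rabs_le_Re_Im a : rabs a <= `|scalar_Re a| + `|scalar_Im a|.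
Proof.
rewrite -(@ler_pXn2r _ 2) ?nnegrE ?rabs_ge0 ?addr_ge0 // rabs_sqr sqrrD.
rewrite !real_normK ?num_real //.
have := normr_ge0 (scalar_Re a); have := normr_ge0 (scalar_Im a); nra.
Qed.

Lemma scalar_Re_le a : `|scalar_Re a| <= rabs a.
Proof.
rewrite -(@ler_pXn2r _ 2) ?nnegrE ?rabs_ge0 // real_normK ?num_real //.
by rewrite rabs_sqr lerDl sqr_ge0.
Qed.

Lemma scalar_Im_le a : `|scalar_Im a| <= rabs a.
Proof.
rewrite -(@ler_pXn2r _ 2) ?nnegrE ?rabs_ge0 // real_normK ?num_real //.
by rewrite rabs_sqr lerDr sqr_ge0.
Qed.

Lemma scalar_ReMr a x : scalar_Re (a * scal F x) = scalar_Re a * x.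
Proof. by case: F a => //= -[u v] /=; rewrite mulr0 subr0. Qed.

Lemma scalar_ImMr a x : scalar_Im (a * scal F x) = scalar_Im a * x.
Proof. by case: F a => /= [a|[u v] /=]; rewrite ?mul0r // mulr0 add0r. Qed.

Lemma rabs_sub_mk a x y :
  rabs (scalar_mk F x y - a) <= `|x - scalar_Re a| + `|y - scalar_Im a|.
Proof.
apply: le_trans (rabs_le_Re_Im _) _.
by case: F a => /= [a|[u v]] //=; rewrite normr0 lerD2l.
Qed.

End Scalars.

(** * The dual of [l_q^N] *)

Section LqDual.
Context {R : realType} {F : scalar_kind}.
Variables (q : R) (N : nat).
Local Notation K := (scalars R F).
Implicit Types (x g : 'I_N -> K).

Definition lq_ball : set ('I_N -> K) :=
  [set g | \sum_k rabs (g k) `^ q <= 1].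

Definition pairing x g : K := \sum_k x k * g k.

(** The norm of l_q' for the conjugate exponent q'. The supremum form treats [q = 1], where q' is
    infinite, together with the other cases. *)
Definition lq_dual_norm x : R := sup [set rabs (pairing x g) | g in lq_ball].

Hypothesis q_ge1 : 1 <= q.

Let q_gt0 : 0 < q. Proof. exact: lt_le_trans q_ge1. Qed.

Lemma lq_ball_le1 g k : lq_ball g -> rabs (g k) <= 1.
Proof.
rewrite /lq_ball /= (bigD1 k) //= => gq; rewrite leNgt; apply/negP => g1.
have : 1 < rabs (g k) `^ q.
  by have := gt0_ltr_powR q_gt0 _ _ g1; rewrite powR1; apply; rewrite nnegrE ?rabs_ge0.
apply/negP; rewrite -leNgt; apply: le_trans gq.
by rewrite lerDl; apply: sumr_ge0 => i _; exact: powR_ge0.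
Qed.

Lemma lq_ball0 : lq_ball (fun=> 0).
Proof.
rewrite /lq_ball /= big1 // => k _.
by rewrite rabs0 powR0 // gt_eqF.
Qed.

Lemma lq_ball_delta k : lq_ball (fun i => (i == k)%:R).
Proof.
rewrite /lq_ball /= (bigD1 k) //= eqxx rabs1 powR1 big1 ?addr0 // => i.
by move=> /negPf ->; rewrite rabs0 powR0 // gt_eqF.
Qed.

Lemma pairing_le_sum x g : lq_ball g -> rabs (pairing x g) <= \sum_k rabs (x k).
Proof.
move=> gB; apply: le_trans (rabs_sum _ _) _; apply: ler_sum => k _.
by rewrite rabsM ler_piMr ?rabs_ge0 // lq_ball_le1.
Qed.

Lemma lq_dual_norm_ge x g : lq_ball g -> rabs (pairing x g) <= lq_dual_norm x.
Proof.
move=> gB; apply: ub_le_sup; last by exists g.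
by exists (\sum_k rabs (x k)) => _ [h hB <-]; exact: pairing_le_sum.
Qed.

Lemma lq_dual_norm_le x M :
  (forall g, lq_ball g -> rabs (pairing x g) <= M) -> lq_dual_norm x <= M.
Proof.
move=> H; apply: ge_sup; first by exists (rabs (pairing x (fun=> 0))), (fun=> 0); [exact: lq_ball0|].
by move=> _ [h hB <-]; exact: H.
Qed.

Lemma lq_dual_norm_le_sum x : lq_dual_norm x <= \sum_k rabs (x k).
Proof. by apply: lq_dual_norm_le => g; exact: pairing_le_sum. Qed.

Lemma pairing_delta x k : pairing x (fun i => (i == k)%:R) = x k.
Proof.
rewrite /pairing (bigD1 k) //= eqxx mulr1 big1 ?addr0 // => i /negPf ->.
by rewrite mulr0.
Qed.

Lemma rabs_le_lq_dual_norm x k : rabs (x k) <= lq_dual_norm x.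
Proof. by rewrite -{1}[x k]pairing_delta lq_dual_norm_ge //; exact: lq_ball_delta. Qed.

Lemma lq_dual_norm_ge0 x : 0 <= lq_dual_norm x.
Proof. exact: le_trans (rabs_ge0 _) (lq_dual_norm_ge x _ lq_ball0). Qed.

Lemma lq_dual_normD x y :
  lq_dual_norm (fun k => x k + y k) <= lq_dual_norm x + lq_dual_norm y.
Proof.
apply: lq_dual_norm_le => g gB.
have -> : pairing (fun k => x k + y k) g = pairing x g + pairing y g.
  by rewrite /pairing -big_split /=; apply: eq_bigr => k _; rewrite mulrDl.
by apply: le_trans (rabsD _ _) _; apply: lerD; exact: lq_dual_norm_ge.
Qed.

Lemma pairingZ (c : K) x g : pairing (fun k => c * x k) g = c * pairing x g.
Proof. by rewrite /pairing mulr_sumr; apply: eq_bigr => k _; rewrite mulrA. Qed.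

Lemma lq_dual_normZ (c : K) x :
  lq_dual_norm (fun k => c * x k) = rabs c * lq_dual_norm x.
Proof.
have le d y : lq_dual_norm (fun k => d * y k) <= rabs d * lq_dual_norm y.
  apply: lq_dual_norm_le => g gB; rewrite pairingZ rabsM.
  by apply: ler_wpM2l; [exact: rabs_ge0 | exact: lq_dual_norm_ge].
apply/eqP; rewrite eq_le le /=.
have [->|cN0] := eqVneq c 0; first by rewrite rabs0 mul0r lq_dual_norm_ge0.
have H := le c^-1 (fun k => c * x k).
have E : (fun k => c^-1 * (c * x k)) = x by apply/funext => k; rewrite mulKf.
rewrite E in H; apply: le_trans (ler_wpM2l (rabs_ge0 c) H) _.
by rewrite mulrA -rabsM mulfV // rabs1 mul1r.
Qed.

Lemma lq_dual_norm_eq0 x : lq_dual_norm x = 0 -> forall k, x k = 0.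
Proof.
move=> x0 k; apply: rabs_eq0; apply/eqP; rewrite eq_le rabs_ge0 andbT -x0.
exact: rabs_le_lq_dual_norm.
Qed.

End LqDual.

(** [q_ge1] is a parameter of the type because the norm axioms depend on it: the instances can then
    be inferred from the type alone. *)
Definition lq_dual (R : realType) (F : scalar_kind) (q : R) (q_ge1 : 1 <= q)
  (N : nat) : Type := {ffun 'I_N -> (scalars R F)^o}.

Section LqDualNormed.
Context {R : realType} {F : scalar_kind} {q : R} {q_ge1 : 1 <= q} {N : nat}.
Local Notation V := (lq_dual R F q q_ge1 N).
Local Notation norm := (fun x : V => scal F (lq_dual_norm q N (x : 'I_N -> scalars R F))).

HB.instance Definition _ :=
  GRing.Lmodule.copy V {ffun 'I_N -> (scalars R F)^o}.

Fact lq_dual_ler_normD (x y : V) : norm (x + y) <= norm x + norm y.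
Proof.
rewrite -rmorphD ler_scal; apply: le_trans (lq_dual_normD q N q_ge1 _ _).
by rewrite le_eqVlt; apply/orP; left; apply/eqP; congr lq_dual_norm; apply/funext => k; rewrite ffunE.
Qed.

Fact lq_dual_normrZ (c : scalars R F) (x : V) : norm (c *: x) = `|c| * norm x.
Proof.
rewrite normr_scal -rmorphM /= -(lq_dual_normZ q N q_ge1).
by congr (scal F (lq_dual_norm _ _ _)); apply/funext => k; rewrite ffunE.
Qed.

Fact lq_dual_normr0_eq0 (x : V) : norm x = 0 -> x = 0.
Proof.
move=> /(congr1 (@scalar_Re R F)); rewrite scalK raddf0 => x0.
by apply/ffunP => k; rewrite ffunE; exact: (lq_dual_norm_eq0 q N q_ge1 _ x0).
Qed.

HB.instance Definition _ := Lmodule_isNormed.Build (scalars R F) V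
  lq_dual_ler_normD lq_dual_normrZ lq_dual_normr0_eq0.

Lemma lq_dual_rnormE (x : V) : rnorm x = lq_dual_norm q N x.
Proof. exact: scalK. Qed.

Lemma lq_dual_normE (x : V) : `|x| = scal F (lq_dual_norm q N x).
Proof. by []. Qed.

(** A 1-Lipschitz real function maps Cauchy filters to Cauchy filters, and the real line is
    complete. *)
Lemma coordinate_cvg (f : V -> R) (G : set_system V) :
  (forall x y : V, `|f x - f y| <= lq_dual_norm q N (x - y)) ->
  ProperFilter G -> cauchy G -> cvg (f @ G).
Proof.
move=> fL GF /cauchyP Gc.
apply: R_complete; apply/cauchyP => e e0.
have [|x Gx] := Gc (scal F e).
  by rewrite -(rmorph0 (scal F)) ltr_scal.
exists (f x); apply: (@filterS _ G _ _ _ _ Gx) => y.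
rewrite /= -!ball_normE /= => xy.
apply: le_lt_trans (fL _ _) _.
by move: xy; rewrite lq_dual_normE ltr_scal.
Qed.

Lemma lq_dual_complete (G : set_system V) : ProperFilter G -> cauchy G -> cvg G.
Proof.
move=> GF Gc.
have Re_cvg k : cvg ((fun x : V => scalar_Re (x k : scalars R F)) @ G).
  apply: coordinate_cvg => // x y; rewrite -raddfB /=.
  apply: le_trans (scalar_Re_le _) _.
  have -> : x k - y k = (x - y) k by rewrite !ffunE.
  exact: rabs_le_lq_dual_norm.
have Im_cvg k : cvg ((fun x : V => scalar_Im (x k : scalars R F)) @ G).
  apply: coordinate_cvg => // x y; rewrite -raddfB /=.
  apply: le_trans (scalar_Im_le _) _.
  have -> : x k - y k = (x - y) k by rewrite !ffunE.
  exact: rabs_le_lq_dual_norm.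
pose r k := lim ((fun x : V => scalar_Re (x k : scalars R F)) @ G).
pose i k := lim ((fun x : V => scalar_Im (x k : scalars R F)) @ G).
pose z : V := [ffun k => scalar_mk F (r k) (i k)].
apply/cvg_ex; exists z; apply/fcvgrPdist_lt => _ /gt0_scal[e e0 ->].
(* Each coordinate deviates by at most 2 d, so the total is at most e N/(N + 1) < e; N + 1 covers N
   = 0. *)
pose d := e / (2 * N.+1%:R).
have d0 : 0 < d by rewrite divr_gt0 // mulr_gt0.
have H : \forall x \near G, forall k,
    `|r k - scalar_Re ((x : V) k : scalars R F)| < d /\
    `|i k - scalar_Im ((x : V) k : scalars R F)| < d.
  apply: filter_forall => k.
  have h1 := (cvgrPdist_lt _ _).1 (Re_cvg k) d d0.
  have h2 := (cvgrPdist_lt _ _).1 (Im_cvg k) d d0.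
  near=> x; split; near: x; [exact: h1 | exact: h2].
apply: filterS H => x H.
rewrite lq_dual_normE ltr_scal.
apply: le_lt_trans (lq_dual_norm_le_sum _ _ q_ge1 _) _.
apply: (@le_lt_trans _ _ (\sum_(k < N) (2 * d))).
  apply: ler_sum => k _; rewrite !ffunE.
  apply: le_trans (rabs_sub_mk _ _ _) _.
  by have [/ltW ? /ltW ?] := H k; lra.
rewrite sumr_const card_ord -[_ *+ N]mulr_natr.
have -> : 2 * d * N%:R = e * (N%:R / N.+1%:R).
  have : N.+1%:R != 0 :> R by rewrite pnatr_eq0.
  by rewrite /d; move: (N.+1%:R) => c cN0; field.
by rewrite gtr_pMr // ltr_pdivrMr // mul1r ltr_nat.
Unshelve. all: by end_near. Qed.

HB.instance Definition _ := Uniform_isComplete.Build V lq_dual_complete.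

End LqDualNormed.

Section LqDualDuality.
Context {R : realType} {F : scalar_kind} {q : R} {q_ge1 : 1 <= q} {N : nat}.
Local Notation K := (scalars R F).
Local Notation V := (lq_dual R F q q_ge1 N).

Let q_gt0 : 0 < q. Proof. exact: lt_le_trans q_ge1. Qed.
Let qN0 : q != 0. Proof. exact: lt0r_neq0. Qed.

Definition pairing_with (g : 'I_N -> K) (x : V) : K^o := pairing N x g.

Lemma pairing_with_is_linear (g : 'I_N -> K) : linear (pairing_with g).
Proof.
move=> c x y; rewrite /pairing_with /pairing scaler_sumr -big_split /=.
by apply: eq_bigr => k _; rewrite !ffunE mulrDl -scalerAl.
Qed.

HB.instance Definition _ (g : 'I_N -> K) :=
  GRing.isLinear.Build K V K^o *:%R (pairing_with g) (pairing_with_is_linear g).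

Definition unit_vector (k : 'I_N) : V := [ffun i => (i == k)%:R].

Lemma lq_dual_decomp (x : V) : x = \sum_k (x k : K) *: unit_vector k.
Proof.
apply/ffunP => i; rewrite sum_ffunE (bigD1 i) //= !ffunE eqxx big1 ?addr0.
  by rewrite [_ *: _]mulr1.
by move=> k ki; rewrite !ffunE eq_sym (negPf ki) [_ *: _]mulr0.
Qed.

(** [opnorm] only controls [f] on the unit ball; rescaling [x] to norm 1 gives the rest, and norm 0
    forces [x = 0]. *)
Lemma dual_ball_le (f : {linear V -> K^o}) (x : V) :
  dual_ball V f -> rabs (f x : K) <= lq_dual_norm q N x.
Proof.
move=> fB; set t := lq_dual_norm q N x.
have [t0|tN0] := eqVneq t 0.
  have -> : x = 0.
    by apply/ffunP => k; rewrite ffunE; apply: (lq_dual_norm_eq0 q N q_ge1 _ t0).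
  by rewrite linear0 rabs0 t0.
have tp : 0 < t by rewrite lt_def tN0 lq_dual_norm_ge0.
have : ((rnorm (f (scal F t^-1 *: x)))%:E <= 1%:E)%E.
  apply: le_trans fB; apply: ereal_sup_ubound; exists (scal F t^-1 *: x) => //=.
  rewrite /rnorm normrZ lq_dual_normE normr_scal rabs_scal -rmorphM scalK.
  by rewrite ger0_norm ?invr_ge0 ?(ltW tp) // -/t mulVf.
rewrite lee_fin linearZ /= /rnorm -/(rabs _) rabsM rabs_scal.
rewrite ger0_norm ?invr_ge0 ?(ltW tp) //.
by rewrite mulrC ler_pdivrMr // mul1r.
Qed.

(* The test vector is the norming vector [x k = |f k|^(q-1) phase(f k)] of
   Hoelder's inequality; Young's inequality covers [q = 1] as well. *)
Lemma dual_ball_lq_ball (f : {linear V -> K^o}) :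
  dual_ball V f -> lq_ball q N (fun k => f (unit_vector k)).
Proof.
move=> fB; pose a k : K := f (unit_vector k).
pose x : V := [ffun k => scal F (rabs (a k) `^ (q - 1)) * phase (a k)].
pose A := \sum_k rabs (a k) `^ q.
have powE k : rabs (a k) `^ (q - 1) * rabs (a k) = rabs (a k) `^ q.
  by rewrite mulrC mulr_powRB1 ?rabs_ge0.
have A0 : 0 <= A by apply: sumr_ge0 => k _; exact: powR_ge0.
have fx : (f x : K) = scal F A.
  rewrite {1}[x]lq_dual_decomp linear_sum rmorph_sum /=; apply: eq_bigr => k _.
  rewrite linearZ /= ffunE -[_ *: _]/(_ * _ : K) -mulrA phaseM -rmorphM /=.
  by rewrite powE.
(* Young's inequality on each coordinate. Together with f x = A it yields A <= (1 - 1/q) A + 1/q,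
   that is A <= 1. *)
have nx : lq_dual_norm q N x <= (1 - q^-1) * A + q^-1.
  apply: lq_dual_norm_le => // g gB.
  apply: le_trans (rabs_sum _ _) _.
  apply: (@le_trans _ _ (\sum_k ((1 - q^-1) * rabs (a k) `^ q + q^-1 * rabs (g k) `^ q))).
    apply: ler_sum => k _; rewrite ffunE 2!rabsM rabs_scal ger0_norm ?powR_ge0 //.
    apply: (@le_trans _ _ (rabs (a k) `^ (q - 1) * rabs (g k))).
      apply: ler_wpM2r; first exact: rabs_ge0.
      by apply: ler_piMr; [exact: powR_ge0 | exact: rabs_phase].
    have q1 : 0 <= q^-1 <= 1 by rewrite invr_ge0 ltW //= invf_le1.
    have := @weighted_amgm R (1 - q^-1) (rabs (a k) `^ q) (rabs (g k) `^ q).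
    rewrite !powR_ge0 subKr -!powRrM mulrBr mulfV // mulr1 powRr1 ?rabs_ge0 //.
    by apply => //; lra.
  rewrite big_split /= -!mulr_sumr -/A; apply: lerD => //.
  by rewrite ler_piMr // invr_ge0 ltW.
have := le_trans (dual_ball_le f x fB) nx.
rewrite fx rabs_scal ger0_norm // mulrBl mul1r => H.
have : q^-1 * A <= q^-1 by lra.
by rewrite -[leRHS]mulr1 ler_pM2l ?invr_gt0.
Qed.

End LqDualDuality.

(** * Weakly summable families *)

(** Signs are chosen one at a time: by the parallelogram identity the energies for the two choices
    of the next sign average to the sum of the separate energies, so one choice reaches it. This
    replaces averaging over random signs. *)
Lemma exists_signs (R : realType) (F : scalar_kind) (I J : finType)
    (v : J -> I -> scalars R F) :
  exists eps : J -> bool,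
    \sum_j \sum_k rabs (v j k) ^+ 2 <=
      \sum_k rabs (\sum_j (-1) ^+ eps j * v j k) ^+ 2.
Proof.
have : uniq (index_enum J) by exact: index_enum_uniq.
elim: (index_enum J) => [_|j s IHs /= /andP[js /IHs[eps Heps]]].
  by exists (fun=> false); rewrite big_nil; apply: sumr_ge0 => k _; exact: sqr_ge0.
pose z k := \sum_(j <- s) (-1) ^+ eps j * v j k.
pose eps' b i := if i == j then b else eps i.
have E b : \sum_k rabs (\sum_(j <- j :: s) (-1) ^+ eps' b j * v j k) ^+ 2 =
    \sum_k rabs (z k + (-1) ^+ b * v j k) ^+ 2.
  apply: eq_bigr => k _; rewrite big_cons {1}/eps' eqxx addrC.
  congr (rabs (_ + _) ^+ 2); apply: eq_big_seq => i si.
  by rewrite /eps'; case: eqP => // ij; rewrite -ij si in js.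
have P : \sum_k rabs (z k + (-1) ^+ false * v j k) ^+ 2 +
         \sum_k rabs (z k + (-1) ^+ true * v j k) ^+ 2 =
    2 * \sum_k rabs (z k) ^+ 2 + 2 * \sum_k rabs (v j k) ^+ 2.
  rewrite !mulr_sumr -!big_split /=; apply: eq_bigr => k _.
  by rewrite expr0 expr1 mul1r mulN1r rabs_parallelogram.
rewrite big_cons.
set S := \sum_(_ <- s) _ in Heps *; set T := \sum_k rabs (v j k) ^+ 2 in P *.
have [h|h] := lerP (T + S) (\sum_k rabs (z k + (-1) ^+ false * v j k) ^+ 2).
  by exists (eps' false); rewrite E.
by exists (eps' true); rewrite E; move: h P Heps; rewrite -/(z _); lra.
Qed.

Lemma lnorm_le (R : realType) (p M : R) (m : nat) (a : 'I_m -> R) :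
  0 < p -> 0 <= M -> (lnorm p a <= M) = (\sum_k a k `^ p <= M `^ p).
Proof.
move=> p0 M0; rewrite /lnorm.
have S0 : 0 <= \sum_k a k `^ p by apply: sumr_ge0 => k _; exact: powR_ge0.
have pN0 := lt0r_neq0 p0.
apply/idP/idP => H.
  rewrite -[leLHS]powRr1 // -(mulVf pN0) powRrM.
  by apply: ge0_ler_powR; rewrite ?nnegrE ?powR_ge0 // ltW.
rewrite -[leRHS]powRr1 // -(mulfV pN0) powRrM.
by apply: ge0_ler_powR; rewrite ?nnegrE ?powR_ge0 ?invr_ge0 // ltW.
Qed.

Section WeakFamilies.
Context {R : realType} {F : scalar_kind} {q : R} {q_ge1 : 1 <= q} {N : nat}.
Local Notation K := (scalars R F).
Local Notation V := (lq_dual R F q q_ge1 N).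

Let q_gt0 : 0 < q. Proof. exact: lt_le_trans q_ge1. Qed.
Let qN0 : q != 0. Proof. exact: lt0r_neq0. Qed.

(** This is where the duality norm enters: the values at the unit vectors of a functional of norm at
    most 1 form a point of the l_q ball. *)
Lemma weak_norm_unit_vectors : (weak_norm q (fun k => unit_vector k : V) <= 1)%E.
Proof.
apply: ge_ereal_sup => _ [f fB <-]; rewrite lee_fin lnorm_le // powR1.
exact: dual_ball_lq_ball.
Qed.

Lemma pairing_with_dual_ball (g : 'I_N -> K) :
  lq_ball q N g -> dual_ball V (pairing_with g).
Proof.
move=> gB; apply: ge_ereal_sup => _ [x x1 <-]; rewrite lee_fin.
by apply: le_trans x1; rewrite lq_dual_rnormE; exact: lq_dual_norm_ge.
Qed.

Context {m : nat} {x : 'I_m -> V}.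
Hypothesis weak_x : (weak_norm q x <= 1)%E.

(** Homogeneous form of weak summability: [g] is divided by its q-norm [t] to become an admissible
    functional. *)
Lemma weak_pairing (g : 'I_N -> K) :
  \sum_j rabs (pairing N (x j) g) `^ q <= \sum_k rabs (g k) `^ q.
Proof.
set G := (X in _ <= X).
have G0 : 0 <= G by apply: sumr_ge0 => k _; exact: powR_ge0.
have [GE|GN0] := eqVneq G 0.
  rewrite GE big1 // => j _. rewrite /pairing big1 ?rabs0 ?powR0 // => k _.
  move/eqP: GE; rewrite psumr_eq0; last by move=> *; exact: powR_ge0.
  move=> /allP/(_ k); rewrite mem_index_enum => /(_ isT)/=.
  by rewrite powR_eq0 qN0 andbT => /eqP/rabs_eq0 ->; rewrite mulr0.
have Gp : 0 < G by rewrite lt_def GN0.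
pose t := G `^ q^-1.
have tp : 0 < t by exact: powR_gt0.
have tq : t `^ q = G by rewrite /t -powRrM mulVf // powRr1.
pose g' k : K := scal F t^-1 * g k.
have tV0 : 0 <= t^-1 by rewrite invr_ge0 ltW.
have tVq : t^-1 `^ q = G^-1.
  by rewrite -powR_inv1 ?(ltW tp) // powRAC tq powR_inv1.
have g'B : lq_ball q N g'.
  rewrite /lq_ball /= /g'.
  under eq_bigr do rewrite rabsM rabs_scal ger0_norm // powRM ?rabs_ge0 // tVq.
  by rewrite -mulr_sumr mulVf.
have : ((lnorm q (fun j => rnorm (pairing_with g' (x j))))%:E <= 1%:E)%E.
  apply: le_trans weak_x; apply: ereal_sup_ubound.
  by exists (pairing_with g') => //; exact: pairing_with_dual_ball.
rewrite lee_fin lnorm_le // powR1.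
have E j : rnorm (pairing_with g' (x j)) `^ q = G^-1 * rabs (pairing N (x j) g) `^ q.
  rewrite -tVq -powRM ?rabs_ge0 //; congr (_ `^ _).
  have -> : pairing_with g' (x j) = scal F t^-1 * pairing N (x j) g.
    rewrite /pairing_with /pairing mulr_sumr; apply: eq_bigr => k _.
    by rewrite mulrCA.
  by rewrite -[LHS]/(rabs _) rabsM rabs_scal ger0_norm.
under eq_bigr do rewrite E.
by rewrite -mulr_sumr mulrC ler_pdivrMr // mul1r.
Qed.

(** Each of the N coordinate functionals contributes at most 1. *)
Lemma weak_coordinates : \sum_j \sum_k rabs (x j k : K) `^ q <= N%:R.
Proof.
rewrite exchange_big /= -[N in leRHS]card_ord -[leRHS]mulr1 mulr_natl -sumr_const.
apply: ler_sum => k _.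
have := le_trans (weak_pairing _) (lq_ball_delta q N q_ge1 k).
apply: le_trans; rewrite le_eqVlt; apply/orP; left; apply/eqP.
by apply: eq_bigr => j _; congr (rabs _ `^ q); rewrite (pairing_delta N).
Qed.

(* The identity of [l_2^N] is [(s,q)]-summing with [1/s = 1/q - 1/2], here
   [s = 2 q / (2 - q)]; the weights [lambda] realize the duality between
   [l_s] and [l_{q'}]. *)
Lemma weak_squares : q < 2 ->
  \sum_j (\sum_k rabs (x j k : K) ^+ 2) `^ (q / (2 - q)) <= N%:R.
Proof.
move=> q2.
pose e := q / (2 - q).
have d0 : 0 < 2 - q by lra.
have e0 : 0 < e by rewrite divr_gt0.
pose B j := \sum_k rabs (x j k : K) ^+ 2.
have B0 j : 0 <= B j by apply: sumr_ge0 => k _; exact: sqr_ge0.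
rewrite -/e -[leLHS]/(\sum_j B j `^ e).
set S := \sum_j B j `^ e.
have S0 : 0 <= S by apply: sumr_ge0 => j _; exact: powR_ge0.
(* Chosen so that l_j^2 B_j = B_j^e and, for q > 1 with conjugate exponent q', the sum of l_j^q' is
   S. *)
pose l j := (B j `^ e) `^ (1 - q^-1).
have l0 j : 0 <= l j by exact: powR_ge0.
have lB j : l j ^+ 2 * B j = B j `^ e.
  have [->|BN0] := eqVneq (B j) 0; first by rewrite mulr0 powR0 ?gt_eqF.
  rewrite /l -powR_mulrn ?powR_ge0 // -!powRrM -{2}[B j]powRr1 //.
  rewrite -powRD; last by rewrite BN0 implybT.
  by congr (_ `^ _); rewrite /e; field; rewrite qN0 gt_eqF.
have [eps Heps] := exists_signs R F _ _ (fun j k => scal F (l j) * (x j k : K)).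
(* By the choice of signs, the squared l_2 norm [Z] of this combination dominates [S]. *)
pose z k : K := \sum_j (-1) ^+ eps j * (scal F (l j) * x j k).
pose Z := \sum_k rabs (z k) ^+ 2.
have Z0 : 0 <= Z by apply: sumr_ge0 => k _; exact: sqr_ge0.
have SZ : S <= Z.
  apply: le_trans Heps; rewrite le_eqVlt; apply/orP; left; apply/eqP.
  apply: eq_bigr => j _; rewrite -lB /B mulr_sumr; apply: eq_bigr => k _.
  by rewrite rabsM rabs_scal ger0_norm // exprMn.
have [SE|SN0] := eqVneq S 0; first by rewrite SE.
have Sp : 0 < S by rewrite lt_def SN0.
have Zp : 0 < Z by exact: lt_le_trans SZ.
(* The conjugate of z, so that pairing it with z gives [Z]. *)
pose g k : K := scal F (rabs (z k)) * phase (z k).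
have gz k : rabs (g k) <= rabs (z k).
  rewrite rabsM rabs_scal ger0_norm ?rabs_ge0 //.
  by apply: ler_piMr; [exact: rabs_ge0 | exact: rabs_phase].
have zg : pairing N z g = scal F Z.
  rewrite rmorph_sum; apply: eq_bigr => k _.
  by rewrite /g mulrC -mulrA phaseM -rmorphM.
have zg' : pairing N z g = \sum_j (-1) ^+ eps j * scal F (l j) * pairing N (x j) g.
  rewrite /pairing /z; under eq_bigr do rewrite mulr_suml.
  rewrite exchange_big /=; apply: eq_bigr => j _; rewrite mulr_sumr.
  by apply: eq_bigr => k _; rewrite !mulrA.
have step1 : Z <= S `^ (1 - q^-1) * (\sum_j rabs (pairing N (x j) g) `^ q) `^ q^-1.
  have -> : Z = rabs (pairing N z g) by rewrite zg rabs_scal ger0_norm.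
  rewrite zg'; apply: le_trans (rabs_sum _ _) _.
  have q1 : 0 <= q^-1 <= 1 by rewrite invr_ge0 ltW //= invf_le1.
  have q1' : 0 <= 1 - q^-1 <= 1 by lra.
  have := @holder2 R _ (1 - q^-1) (fun j => B j `^ e)
    (fun j => rabs (pairing N (x j) g) `^ q) q1'
    (fun _ => powR_ge0 _ _) (fun _ => powR_ge0 _ _).
  rewrite subKr; apply: le_trans; apply: ler_sum => j _.
  rewrite -(powRrM _ q) mulfV // powRr1 ?rabs_ge0 //.
  rewrite !rabsM rabs_scal ger0_norm // -/(l j).
  rewrite -signr_odd; case: (odd _); rewrite ?expr1 ?expr0 ?rabsN rabs1 mul1r //.
(* Weak summability, then |z|_q <= N^(1/q - 1/2) |z|_2. *)
have step2 : \sum_j rabs (pairing N (x j) g) `^ q <= Z `^ (q / 2) * N%:R `^ (1 - q / 2).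
  apply: le_trans (weak_pairing g) _.
  apply: (@le_trans _ _ (\sum_k (rabs (z k) ^+ 2) `^ (q / 2) * 1 `^ (1 - q / 2))).
    apply: ler_sum => k _; rewrite powR1 mulr1 -powR_mulrn ?rabs_ge0 // -powRrM.
    rewrite mulrCA mulfV ?mulr1 //.
    by apply: ge0_ler_powR; rewrite ?nnegrE ?rabs_ge0 // ltW.
  apply: le_trans (holder2 _ _ _ _ _ _ _ _) _ => //.
  - by rewrite divr_ge0 ?(ltW q_gt0) //= ler_pdivrMr // mul1r ltW.
  - by move=> k; exact: sqr_ge0.
  by rewrite sumr_const card_ord.
have step3 : Z <= S `^ (1 - q^-1) * (Z `^ 2^-1 * N%:R `^ (q^-1 - 2^-1)).
  apply: le_trans step1 _; apply: ler_wpM2l; first exact: powR_ge0.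
  have -> : Z `^ 2^-1 * N%:R `^ (q^-1 - 2^-1) =
      (Z `^ (q / 2) * N%:R `^ (1 - q / 2)) `^ q^-1.
    rewrite powRM ?powR_ge0 // -!powRrM.
    by congr (_ `^ _ * _ `^ _); field.
  apply: ge0_ler_powR; rewrite ?nnegrE ?invr_ge0 ?(ltW q_gt0) //.
  - by apply: sumr_ge0 => *; exact: powR_ge0.
  by rewrite mulr_ge0 ?powR_ge0.
have step4 : Z `^ 2^-1 <= S `^ (1 - q^-1) * N%:R `^ (q^-1 - 2^-1).
  rewrite -(ler_pM2l (powR_gt0 2^-1 Zp)) -powRD; last by rewrite gt_eqF ?implybT.
  have -> : 2^-1 + 2^-1 = 1 :> R by field.
  by rewrite powRr1 // mulrCA.
(* Since S <= Z, the left side of [step4] may be lowered to S^(1/2); cancelling S^(1 - 1/q) leaves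
   the exponent 1/q - 1/2, positive because q < 2. *)
have step5 : S `^ (q^-1 - 2^-1) <= N%:R `^ (q^-1 - 2^-1).
  rewrite -(ler_pM2l (powR_gt0 (1 - q^-1) Sp)); apply: le_trans step4.
  rewrite -powRD; last by rewrite SN0 implybT.
  have -> : 1 - q^-1 + (q^-1 - 2^-1) = 2^-1 by field.
  by apply: ge0_ler_powR; rewrite ?nnegrE ?invr_ge0.
have ep : 0 < q^-1 - 2^-1 by rewrite subr_gt0 ltf_pV2 ?posrE.
rewrite leNgt; apply/negP => NS; move: step5; apply/negP; rewrite -ltNge.
by apply: gt0_ltr_powR; rewrite ?nnegrE.
Qed.

End WeakFamilies.

(** * The test operator *)

Section Synthesis.
Context {R : realType} {F : scalar_kind} {q : R} {q_ge1 : 1 <= q} {N n : nat}.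
Variable y : 'I_N -> 'I_n -> R.
Local Notation K := (scalars R F).
Local Notation V := (lq_dual R F q q_ge1 N).
Local Notation W := (lq_dual R F 2 (ler1n R 2) n).

(** The target is the dual of l_2^n, hence l_2^n itself, so that one family of types serves for both
    spaces. *)
Definition synthesis (x : V) : W :=
  [ffun i => (\sum_k (x k : K) * scal F (y k i) : K)].

Lemma synthesis_is_linear : linear synthesis.
Proof.
move=> c u v; apply/ffunP => i; rewrite !ffunE.
rewrite scaler_sumr -big_split /=; apply: eq_bigr => k _.
by rewrite !ffunE mulrDl -scalerAl.
Qed.

HB.instance Definition _ := GRing.isLinear.Build K V W *:%R synthesis
  synthesis_is_linear.

Definition analysis (v : 'I_n -> K) (k : 'I_N) : K :=
  \sum_i v i * scal F (y k i).

Lemma pairing_synthesis (x : V) (v : 'I_n -> K) :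
  pairing n (synthesis x) v = pairing N x (analysis v).
Proof.
rewrite /pairing; under eq_bigr do rewrite ffunE mulr_suml.
rewrite exchange_big /=; apply: eq_bigr => k _.
by rewrite mulr_sumr; apply: eq_bigr => i _; rewrite -mulrA [scal F _ * _]mulrC.
Qed.

Lemma synthesis_unit_vector (k : 'I_N) (i : 'I_n) :
  synthesis (unit_vector k) i = scal F (y k i).
Proof.
rewrite ffunE (bigD1 k) //= !ffunE eqxx mul1r big1 ?addr0 // => j jk.
by rewrite ffunE (negPf jk) mul0r.
Qed.

(** [y k] itself lies in the l_2 ball and serves as norming vector. *)
Lemma synthesis_unit_vector_ge1 (k : 'I_N) :
  dot (y k) (y k) = 1 -> 1 <= rnorm (synthesis (unit_vector k)).
Proof.
move=> y1; rewrite lq_dual_rnormE.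
have yB : lq_ball (F := F) 2 n (fun i => scal F (y k i)).
  rewrite /lq_ball /= -[leRHS]y1; apply: ler_sum => i _.
  by rewrite rabs_scal powR_mulrn // real_normK ?num_real // expr2.
have := lq_dual_norm_ge 2 n (ler1n R 2) (synthesis (unit_vector k)) _ yB.
apply: le_trans; rewrite /pairing.
under eq_bigr do rewrite synthesis_unit_vector -rmorphM /=.
by rewrite -rmorph_sum rabs_scal -/(dot _ _) y1 normr1.
Qed.

(** The standard basis occurs among the [y k], so the operator is onto. *)
Lemma synthesis_has_rank :
  (forall i, exists k, forall j, y k j = (i == j)%:R) -> has_rank synthesis n.
Proof.
move=> ybasis; exists unit_vector; split=> [a a0 i|].
  have /ffunP/(_ i) := a0.
  rewrite sum_ffunE (bigD1 i) //= !ffunE eqxx big1 ?addr0.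
    by rewrite [_ *: _]mulr1.
  by move=> k ki; rewrite !ffunE eq_sym (negPf ki) [_ *: _]mulr0.
apply/seteqP; split=> [_ [x _ <-]|_ [a _ <-]].
  by exists (fun i => synthesis x i) => //; rewrite -lq_dual_decomp.
have [s sP] := choice ybasis.
exists (\sum_i a i *: unit_vector (s i)) => //.
rewrite linear_sum; apply: eq_bigr => i _; rewrite linearZ /=; congr (_ *: _).
apply/ffunP => j; rewrite synthesis_unit_vector sP ffunE eq_sym.
by case: (_ == _); rewrite ?rmorph1 ?rmorph0.
Qed.

(** The [y k] are real, so the real and imaginary parts of [v] are analysed separately, each being a
    real vector in the unit ball; |a + ib| <= 2 max(|a|, |b|) recombines them. *)
Lemma analysis_power_sum (rho C : R) (v : 'I_n -> K) : 0 < rho ->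
  (forall u, dot u u <= 1 -> \sum_k `|dot u (y k)| `^ rho <= C) ->
  lq_ball 2 n v -> \sum_k rabs (analysis v k) `^ rho <= 2 `^ rho * (C + C).
Proof.
move=> rho0 yC vB.
have vB2 : \sum_i rabs (v i) ^+ 2 <= 1.
  apply: le_trans vB; apply: ler_sum => i _.
  by rewrite -powR_mulrn ?rabs_ge0.
have ReB : dot (fun i => scalar_Re (v i)) (fun i => scalar_Re (v i)) <= 1.
  apply: le_trans vB2; apply: ler_sum => i _.
  by rewrite -expr2 rabs_sqr lerDl sqr_ge0.
have ImB : dot (fun i => scalar_Im (v i)) (fun i => scalar_Im (v i)) <= 1.
  apply: le_trans vB2; apply: ler_sum => i _.
  by rewrite -expr2 rabs_sqr lerDr sqr_ge0.
apply: le_trans (ler_wpM2l (powR_ge0 _ _) (lerD (yC _ ReB) (yC _ ImB))).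
rewrite -big_split /= mulr_sumr; apply: ler_sum => k _.
set a := `|dot _ _|; set b := `|dot _ _|.
have a0 : 0 <= a by exact: normr_ge0.
have b0 : 0 <= b by exact: normr_ge0.
have hab : rabs (analysis v k) <= 2 * Num.max a b.
  apply: le_trans (rabs_le_Re_Im _) _.
  have -> : `|scalar_Re (analysis v k)| = a.
    rewrite /analysis raddf_sum /= /a /dot; congr `|_|.
    by apply: eq_bigr => i _ /=; rewrite scalar_ReMr.
  have -> : `|scalar_Im (analysis v k)| = b.
    rewrite /analysis raddf_sum /= /b /dot; congr `|_|.
    by apply: eq_bigr => i _ /=; rewrite scalar_ImMr.
  have : a <= Num.max a b by rewrite le_max lexx.
  have : b <= Num.max a b by rewrite le_max lexx orbT.
  by lra.
have m0 : 0 <= Num.max a b by rewrite le_max a0.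
apply: (@le_trans _ _ ((2 * Num.max a b) `^ rho)).
  by apply: ge0_ler_powR; rewrite ?nnegrE ?rabs_ge0 ?(ltW rho0) ?mulr_ge0.
rewrite powRM //; apply: ler_wpM2l; first exact: powR_ge0.
by case: (leP a b) => _; rewrite ?lerDl ?lerDr powR_ge0.
Qed.

Lemma synthesis_bounded (x : V) (M : R) :
  (forall v, lq_ball 2 n v -> rabs (pairing N x (analysis v)) <= M) ->
  rnorm (synthesis x) <= M.
Proof.
move=> H; rewrite lq_dual_rnormE; apply: lq_dual_norm_le; first exact: ler1n.
by move=> v vB; rewrite pairing_synthesis H.
Qed.

Lemma synthesis_opnorm_fin : (opnorm synthesis < +oo)%E.
Proof.
pose M := \sum_(k < N) \sum_(i < n) `|y k i|.
apply: (@le_lt_trans _ _ M%:E); last exact: ltry.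
apply: ge_ereal_sup => _ [x x1 <-]; rewrite lee_fin.
apply: synthesis_bounded => v vB.
apply: le_trans (rabs_sum _ _) _; apply: ler_sum => k _; rewrite rabsM.
apply: (@le_trans _ _ (1 * rabs (analysis v k))).
  apply: ler_wpM2r; first exact: rabs_ge0.
  apply: le_trans x1; rewrite lq_dual_rnormE; exact: rabs_le_lq_dual_norm.
rewrite mul1r; apply: le_trans (rabs_sum _ _) _; apply: ler_sum => i _.
rewrite rabsM rabs_scal ler_piMl //.
by apply: lq_ball_le1 vB; exact: ler1n.
Qed.

Lemma synthesis_summing_norm_ge (p : R) : 0 < p ->
  (forall k, dot (y k) (y k) = 1) ->
  ((N%:R `^ p^-1)%:E <= summing_norm p q synthesis)%E.
Proof.
move=> p0 y1.
apply: (@le_trans _ _ (summing_norm_m p q N synthesis)); last first.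
  by apply: ereal_sup_ubound; exists N.
apply: (@le_trans _ _ (lnorm p (fun k => rnorm (synthesis (unit_vector k))))%:E).
  rewrite lee_fin /lnorm; apply: ge0_ler_powR; rewrite ?nnegrE ?invr_ge0 ?(ltW p0) //.
    by apply: sumr_ge0 => *; exact: powR_ge0.
  rewrite -[N in leLHS]card_ord -[leLHS]mulr1 mulr_natl -sumr_const.
  apply: ler_sum => k _; apply: (@le_trans _ _ (1 `^ p)); first by rewrite powR1.
  have h := synthesis_unit_vector_ge1 k (y1 k).
  by apply: ge0_ler_powR; rewrite ?nnegrE ?(ltW p0) // (le_trans _ h).
apply: ereal_sup_ubound; exists (@unit_vector R F q q_ge1 N) => //=.
exact: weak_norm_unit_vectors.
Qed.

End Synthesis.

(** * Upper bounds for families of few vectors *)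

Section FewVectors.
Context {R : realType} {F : scalar_kind} {p q : R} {q_ge1 : 1 <= q}.
Hypothesis le_qp : q <= p.

Let q_gt0 : 0 < q. Proof. exact: lt_le_trans q_ge1. Qed.
Let p_gt0 : 0 < p. Proof. exact: lt_le_trans le_qp. Qed.
Let pN0 : p != 0. Proof. exact: lt0r_neq0. Qed.
Let qN0 : q != 0. Proof. exact: lt0r_neq0. Qed.

(** By [weak_pairing], the pairing of a single [x j] with [analysis v] is at most the q-norm of
    [analysis v], which is bounded in terms of [C]. So each of the m terms obeys the same bound. *)
Lemma few_vectors_gt2 (C : R) (N n m : nat) (y : 'I_N -> 'I_n -> R) :
  0 <= C ->
  (forall u, dot u u <= 1 -> \sum_k `|dot u (y k)| `^ q <= C) ->
  (summing_norm_m p q m (synthesis (F := F) (q_ge1 := q_ge1) y) <=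
     ((2 `^ q * (C + C)) `^ q^-1 * m%:R `^ p^-1)%:E)%E.
Proof.
move=> C0 yC; apply: ge_ereal_sup => _ [x /= weak_x <-].
set D := _ `^ q^-1.
have D0 : 0 <= D by exact: powR_ge0.
have CC : 0 <= C + C by exact: addr_ge0.
rewrite lee_fin lnorm_le // ?mulr_ge0 ?powR_ge0 //.
rewrite powRM ?powR_ge0 // -powRrM mulVf // powRr1 // mulr_natr.
rewrite -[m in leRHS]card_ord -sumr_const; apply: ler_sum => j _.
apply: ge0_ler_powR; rewrite ?nnegrE ?(ltW p_gt0) //.
  by rewrite lq_dual_rnormE lq_dual_norm_ge0 // ler1n.
apply: synthesis_bounded => v vB.
rewrite -[leLHS]powRr1 ?rabs_ge0 // -(mulfV qN0) powRrM.
apply: ge0_ler_powR; rewrite ?nnegrE ?powR_ge0 ?invr_ge0 ?(ltW q_gt0) //.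
  by rewrite mulr_ge0 ?powR_ge0.
apply: le_trans (analysis_power_sum y q C v q_gt0 yC vB).
apply: le_trans (weak_pairing weak_x _).
by rewrite [leRHS](bigD1 j) //= lerDl; apply: sumr_ge0 => *; exact: powR_ge0.
Qed.

(* Interpolates between [weak_coordinates] (weight [1 - theta]) and
   [weak_squares] (weight [theta]). *)
Lemma few_vectors_lt2 (theta C : R) (N n m : nat) (y : 'I_N -> 'I_n -> R) :
  let l := 1 - (1 - theta) / q - theta / 2 in
  let eta := p^-1 - (q^-1 - theta / 2) in
  q < 2 -> 0 < theta < 1 -> 0 < eta -> 0 < l -> 0 <= C ->
  (forall u, dot u u <= 1 -> \sum_k `|dot u (y k)| `^ l^-1 <= C) ->
  (summing_norm_m p q m (synthesis (F := F) (q_ge1 := q_ge1) y) <=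
     ((2 `^ l^-1 * (C + C)) `^ l * m%:R `^ eta * N%:R `^ (p^-1 - eta))%:E)%E.
Proof.
move=> l eta q2 /andP[t0 t1] eta0 l0 C0 yC.
apply: ge_ereal_sup => _ [x /= weak_x <-].
have CC : 0 <= C + C by exact: addr_ge0.
set D := _ `^ l.
have D0 : 0 <= D by exact: powR_ge0.
pose l1 := (1 - theta) / q; pose l2 := theta / 2.
have l10 : 0 < l1 by rewrite divr_gt0 // subr_gt0.
have l20 : 0 < l2 by rewrite divr_gt0.
pose A j := \sum_k rabs (x j k : scalars R F) `^ q.
pose B j := \sum_k rabs (x j k : scalars R F) ^+ 2.
have A0 j : 0 <= A j by apply: sumr_ge0 => *; exact: powR_ge0.
have B0 j : 0 <= B j by apply: sumr_ge0 => *; exact: sqr_ge0.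
(* Hoelder with weights l1 + l2 + l = 1, after writing |x_k| = |x_k|^(1 - theta) |x_k|^theta. *)
have Tx j : rnorm (synthesis y (x j)) <= A j `^ l1 * B j `^ l2 * D.
  apply: synthesis_bounded => v vB.
  apply: le_trans (rabs_sum _ _) _.
  have abl a : 0 <= a -> (a `^ q) `^ l1 * (a ^+ 2) `^ l2 = a.
    move=> a0; rewrite -powR_mulrn // -!powRrM /l1 /l2.
    rewrite [q * _]mulrC divfK // [_ * (theta / 2)]mulrC divfK //.
    by rewrite -powRD subrK ?powRr1 // oner_eq0.
  apply: (@le_trans _ _ (\sum_k (rabs (x j k : scalars R F) `^ q) `^ l1 *
      (rabs (x j k : scalars R F) ^+ 2) `^ l2 *
      (rabs (analysis y v k) `^ l^-1) `^ l)).
    apply: ler_sum => k _; rewrite rabsM abl ?rabs_ge0 //.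
    by rewrite -powRrM mulVf ?gt_eqF // powRr1 ?rabs_ge0.
  apply: le_trans (holder3 _ _ _ _ _ _ _ _ l10 l20 l0 _ _ _ _) _.
  - by rewrite /l -/l1 -/l2; lra.
  - by move=> k; exact: powR_ge0.
  - by move=> k; exact: sqr_ge0.
  - by move=> k; exact: powR_ge0.
  apply: ler_wpM2l; first by rewrite mulr_ge0 ?powR_ge0.
  apply: ge0_ler_powR; rewrite ?nnegrE ?(ltW l0) //.
  - by apply: sumr_ge0 => *; exact: powR_ge0.
  - by rewrite mulr_ge0 ?powR_ge0.
  by apply: analysis_power_sum vB; rewrite ?invr_gt0.
pose e := q / (2 - q).
have q2' : 0 < 2 - q by rewrite subr_gt0.
have e0 : 0 < e by rewrite divr_gt0.
have eN0 := lt0r_neq0 e0.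
(* Weights of a second Hoelder inequality, over j, whose third factor is the constant 1 and produces
   the power of m. [sum2] identifies the power of N. *)
have sum1 : p * l1 + p * l2 / e + p * eta = 1.
  by rewrite /e /eta /l1 /l2; field; rewrite pN0 qN0 gt_eqF.
have sum2 : l1 + l2 / e = p^-1 - eta.
  by rewrite /e /eta /l1 /l2; field; rewrite pN0 qN0 gt_eqF.
clearbody D; rewrite lee_fin lnorm_le // ?mulr_ge0 ?powR_ge0 //.
rewrite !powRM ?mulr_ge0 ?powR_ge0 // -!powRrM -sum2.
apply: (@le_trans _ _ (\sum_j D `^ p *
    (A j `^ (p * l1) * (B j `^ e) `^ (p * l2 / e) * 1 `^ (p * eta)))).
  apply: ler_sum => j _.
  apply: (@le_trans _ _ ((A j `^ l1 * B j `^ l2 * D) `^ p)).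
    apply: ge0_ler_powR; rewrite ?nnegrE ?(ltW p_gt0) ?mulr_ge0 ?powR_ge0 //.
    by rewrite lq_dual_rnormE lq_dual_norm_ge0 // ler1n.
  rewrite !powRM ?mulr_ge0 ?powR_ge0 // -!powRrM powR1 mulr1.
  rewrite [e * _]mulrC divfK // [l1 * p]mulrC [l2 * p]mulrC.
  by rewrite [leLHS]mulrC.
rewrite -mulr_sumr -[leRHS]mulrA; apply: ler_wpM2l; first exact: powR_ge0.
have pl20 : 0 < p * l2 / e by rewrite divr_gt0 // mulr_gt0.
apply: le_trans (holder3 _ _ _ _ _ _ _ _ (mulr_gt0 p_gt0 l10) pl20
  (mulr_gt0 p_gt0 eta0) sum1 _ _ _) _ => //.
  by move=> j; exact: powR_ge0.
rewrite sumr_const card_ord mulrC [eta * p]mulrC.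
apply: ler_wpM2l; first exact: powR_ge0.
rewrite mulrDl powRD; last first.
  have l2e0 : 0 < l2 / e by rewrite divr_gt0.
  by rewrite gt_eqF // addr_gt0 // mulr_gt0.
rewrite [l1 * p]mulrC [l2 / e * p]mulrC [p * (l2 / e)]mulrA.
apply: ler_pM; rewrite ?powR_ge0 //.
  apply: ge0_ler_powR; rewrite ?nnegrE ?(ltW (mulr_gt0 p_gt0 l10)) //.
    exact: sumr_ge0.
  exact: weak_coordinates weak_x.
apply: ge0_ler_powR; rewrite ?nnegrE ?(ltW pl20) //.
  by apply: sumr_ge0 => *; exact: powR_ge0.
exact: weak_squares weak_x q2.
Qed.

Lemma few_vectors : q <> 2 -> q^-1 - p^-1 < 2^-1 ->
  exists rho eta : R, [/\ 2 < rho, 0 < eta &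
    forall C : R, 0 <= C -> exists2 D : R, 0 <= D &
    forall (N n m : nat) (y : 'I_N -> 'I_n -> R),
      (forall u, dot u u <= 1 -> \sum_k `|dot u (y k)| `^ rho <= C) ->
      (summing_norm_m p q m (synthesis (F := F) (q_ge1 := q_ge1) y) <=
         (D * m%:R `^ eta * N%:R `^ (p^-1 - eta))%:E)%E].
Proof.
move=> /eqP q2 pq.
have pV0 : 0 < p^-1 by rewrite invr_gt0.
have qV0 : 0 < q^-1 by rewrite invr_gt0.
case: (ltgtP q 2) q2 => // q2 _; last first.
  exists q, p^-1; split=> // C C0; exists ((2 `^ q * (C + C)) `^ q^-1).
    exact: powR_ge0.
  by move=> N n m y yC; rewrite subrr powRr0 mulr1 few_vectors_gt2.
(* The midpoint of 2 (1/q - 1/p) and 1: eta > 0 asks for theta above the first, and theta < 1 is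
   needed as well; there is room because 1/q - 1/p < 1/2. *)
pose theta := q^-1 - p^-1 + 2^-1.
have pq0 : 0 <= q^-1 - p^-1 by rewrite subr_ge0 lef_pV2 ?posrE.
have t0 : 0 < theta by rewrite /theta; lra.
have t1 : theta < 1 by rewrite /theta; lra.
pose l := 1 - (1 - theta) / q - theta / 2.
have lq : (1 - theta) / q <= 1 - theta.
  by rewrite ler_pdivrMr // ler_pMr // subr_gt0.
have lq2 : (1 - theta) / 2 < (1 - theta) / q.
  by rewrite ltr_pM2l ?subr_gt0 // ltf_pV2 ?posrE.
have l0 : 0 < l by rewrite /l; lra.
(* This becomes rho > 2: as q < 2, (1 - theta)/q exceeds (1 - theta)/2, so 1 - l exceeds 1/2. *)
have l2 : l < 2^-1 by rewrite /l; lra.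
pose eta := p^-1 - (q^-1 - theta / 2).
have eta0 : 0 < eta by rewrite /eta /theta; lra.
exists l^-1, eta; split=> //.
  by rewrite -[ltLHS]invrK ltf_pV2 ?posrE ?invr_gt0.
move=> C C0; exists ((2 `^ l^-1 * (C + C)) `^ l); first exact: powR_ge0.
by move=> N n m y yC; apply: few_vectors_lt2; rewrite ?t0.
Qed.

End FewVectors.

(** * Growth of the number of vectors *)

(** Tested on the zero family. Nonnegativity allows an arbitrary constant c to be replaced by
    |c|. *)
Lemma summing_norm_m_ge0 (R : realType) (F : scalar_kind) (p q : R) (m : nat)
    (X Y : normedModType (scalars R F)) (T : {linear X -> Y}) :
  0 < q -> (0 <= summing_norm_m p q m T)%E.
Proof.
move=> q0.
apply: (@le_trans _ _ (lnorm p (fun k : 'I_m => rnorm (T 0)))%:E).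
  by rewrite lee_fin powR_ge0.
apply: ereal_sup_ubound; exists (fun=> 0) => //=.
apply: ge_ereal_sup => _ [f _ <-]; rewrite lee_fin lnorm_le // powR1.
rewrite big1 // => k _; rewrite linear0 /rnorm -/(rabs _).
by rewrite rabs0 powR0 // gt_eqF.
Qed.

(** For finite r the difference is 1/r < 1/2; for infinite r the inverse is 0. *)
Lemma inv_exponents_lt_half (R : realType) (p q : R) (r : \bar R) :
  (2%:E < r)%E -> ((q^-1)%:E = (p^-1)%:E + r^-1)%E -> q^-1 - p^-1 < 2^-1.
Proof.
case: r => [r| |] //=.
  rewrite lte_fin => r2; have r0 : 0 < r by lra.
  rewrite inver gt_eqF // -EFinD => -[->].
  by rewrite addrC addKr ltf_pV2 ?posrE.
by move=> _; rewrite invey adde0 => -[->]; rewrite subrr invr_gt0.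
Qed.

Lemma powR_root_le (R : realType) (eta a b M : R) :
  0 < eta -> 0 <= a -> 0 <= b -> 0 <= M -> a `^ eta <= M * b `^ eta ->
  a <= M `^ eta^-1 * b.
Proof.
move=> eta0 a0 b0 M0 H.
have K c : 0 <= c -> (c `^ eta) `^ eta^-1 = c.
  by move=> c0; rewrite -powRrM mulfV ?powRr1 // gt_eqF.
rewrite -(K a a0) -(K b b0) -powRM ?powR_ge0 //.
by apply: ge0_ler_powR; rewrite ?nnegrE ?invr_ge0 ?(ltW eta0) ?mulr_ge0 ?powR_ge0.
Qed.

Theorem theorem4 (R : realType) (F : scalar_kind) (p q : R) (r : \bar R)
    (q_ge1 : 1 <= q) (le_qp : q <= p) (le_qr : (q%:E <= r)%E)
    (pqr : ((q^-1)%:E = (p^-1)%:E + r^-1)%E)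
    (q_neq2 : q <> 2) (r_gt2 : (2%:E < r)%E) :
  exists alpha : R, 1 < alpha /\
    forall k : nat -> nat,
      (exists c : R, forall n : nat, (0 < n)%N ->
        forall (X Y : completeNormedModType (scalars R F))
               (T : {linear X -> Y}),
          (opnorm T < +oo)%E -> has_rank T n ->
          (summing_norm p q T <= c%:E * summing_norm_m p q (k n) T)%E) ->
      exists cbar : R, forall n : nat, (0 < n)%N ->
        n%:R `^ alpha <= cbar * (k n)%:R.
Proof.
have q0 : 0 < q by exact: lt_le_trans q_ge1.
have p0 : 0 < p by exact: lt_le_trans le_qp.
have [rho [eta [rho2 eta0 upper]]] := few_vectors (F := F) (q_ge1 := q_ge1)
  le_qp q_neq2 (inv_exponents_lt_half _ _ _ _ r_gt2 pqr).
(* [rho] and [eta] come from [p] and [q] alone, so [alpha] is fixed before the sequence [k]. *)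
have [alpha [C [alpha1 spread]]] := spread_vectors R rho rho2.
(* [spread] records no sign for [C], hence the absolute value. *)
have [D D0 upperC] := upper `|C| (normr_ge0 C).
exists alpha; split=> // k [c kc].
exists (`|C| * (`|c| * D) `^ eta^-1) => n n0.
have [N [y [nN y1 ybasis yC]]] := spread n n0.
pose T : {linear lq_dual R F q q_ge1 N -> lq_dual R F 2 (ler1n R 2) n} :=
  synthesis y.
have NT := synthesis_summing_norm_ge (F := F) (q_ge1 := q_ge1) y p p0 y1.
have Tk := kc n n0 _ _ T (synthesis_opnorm_fin y) (synthesis_has_rank y ybasis).
have TN := upperC N n (k n) y (fun u u1 => le_trans (yC u u1) (ler_norm C)).
have n_gt0 : 0 < n%:R `^ alpha :> R by rewrite powR_gt0 // ltr0n.
have N0 : 0 < N%:R :> R.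
  rewrite lt_def ler0n andbT; apply: contraTneq (lt_le_trans n_gt0 nN) => ->.
  by rewrite mulr0 ltxx.
have main : N%:R `^ p^-1 <=
    `|c| * (D * (k n)%:R `^ eta * N%:R `^ (p^-1 - eta)).
  rewrite -lee_fin; apply: le_trans NT _; apply: le_trans Tk _.
  rewrite EFinM; apply: (@le_trans _ _ (`|c|%:E * summing_norm_m p q (k n) T)%E).
    by apply: lee_wpmul2r; [exact: summing_norm_m_ge0 | rewrite lee_fin ler_norm].
  by apply: lee_wpmul2l; rewrite // lee_fin.
(* Division by N^(1/p - eta); the root of order eta is taken next. *)
have Neta : N%:R `^ eta <= `|c| * D * (k n)%:R `^ eta.
  rewrite -(ler_pM2r (powR_gt0 (p^-1 - eta) N0)) -powRD; last first.
    by rewrite (gt_eqF N0) implybT.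
  by rewrite [eta + _]addrC subrK -!mulrA; move: main; rewrite -!mulrA.
have Nk : N%:R <= (`|c| * D) `^ eta^-1 * (k n)%:R.
  by apply: powR_root_le => //; rewrite mulr_ge0.
rewrite -mulrA; apply: le_trans (ler_wpM2l (normr_ge0 C) Nk).
by apply: le_trans nN _; apply: ler_wpM2r; [exact: ltW | exact: ler_norm].
Qed.
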